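(* Let $m\ge 1$ worker nodes be given, and for $i\in\{1,\dots,m\}$ let $\mathcal{D}_i$ be a data distribution and $F_i(\bm{x}) := \mathbb{E}_{\bm{s}\sim\mathcal{D}_i}[\ell(\bm{x};\bm{s})]$ for $\bm{x}\in\mathbb{R}^d$, and set $F(\bm{x}) := \frac{1}{m}\sum_{i=1}^m F_i(\bm{x})$. Assume that $F$ is bounded below, with $F_{\inf} := \inf_{\bm{x}} F(\bm{x}) > -\infty$, and that: (1) each $F_i$ is $L$-smooth: $\|\nabla F_i(\bm{x})-\nabla F_i(\bm{y})\|\le L\|\bm{x}-\bm{y}\|$ for all $\bm{x},\bm{y}$ and all $i$; (2) the stochastic gradients are unbiased: $\mathbb{E}_{\xi\sim\mathcal{D}_i}[g_i(\bm{x};\xi)]=\nabla F_i(\bm{x})$; (3) $\mathbb{E}_{\xi\sim\mathcal{D}_i}[\|g_i(\bm{x};\xi)-\nabla F_i(\bm{x})\|^2]\le\sigma^2$ for all $\bm{x}$ and $i$; (4) $\frac{1}{m}\sum_{i=1}^m\|\nabla F_i(\bm{x})-\nabla F(\bm{x})\|^2\le\kappa^2$ for all $\bm{x}$. Fix an integer $\tau\ge1$, a parameter $\alpha\in(0,1)$, a total number of iterations $K$, and a learning rate $\gamma>0$. Consider the Overlap-Local-SGD iteration: local models $\bm{x}_k^{(i)}\in\mathbb{R}^d$ and an anchor model $\bm{z}_k\in\mathbb{R}^d$, all initialized at the same point, $\bm{x}_0^{(i)}=\bm{z}_0$ for all $i$, and for $k\ge0$ $$\bm{x}^{(i)}_{k+\frac12}=\bm{x}^{(i)}_k-\gamma\,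 g_i(\bm{x}^{(i)}_k;\xi^{(i)}_k),$$ where $\xi_k^{(i)}\sim\mathcal{D}_i$ is a freshly sampled mini-batch, and $$\bm{x}^{(i)}_{k+1}=\begin{cases}\bm{x}^{(i)}_{k+\frac12}-\alpha\big(\bm{x}^{(i)}_{k+\frac12}-\bm{z}_k\big), & (k+1)\bmod\tau=0,\\ \bm{x}^{(i)}_{k+\frac12}, &\text{otherwise},\end{cases}\qquad \bm{z}_{k+1}=\begin{cases}\frac1m\sum_{i=1}^m\bm{x}^{(i)}_{k+1}, & (k+1)\bmod\tau=0,\\ \bm{z}_k, &\text{otherwise}.\end{cases}$$ Define $\bm{y}_k := \frac{1-\alpha}{m}\sum_{i=1}^m\bm{x}^{(i)}_k+\alpha\bm{z}_k$. If $\gamma=\frac1L\sqrt{\frac{m}{K}}$ and $K\ge 60\,m\tau^2/\alpha^2$, then $$\frac1K\sum_{k=0}^{K-1}\mathbb{E}\big[\|\nabla F(\bm{y}_k)\|^2\big]\le\frac{4L[F(\bm{y}_0)-F_{\inf}]}{(1-\alpha)\sqrt{mK}}+\frac{2(1-\alpha)\sigma^2}{\sqrt{mK}}+\frac{2m\sigma^2}{K}\left[\frac{2}{(2-\alpha)\alpha}\tau-1\right]+\frac{2m\tau^2\kappa^2}{\alpha^2K},$$ which is $\mathcal{O}\big(1/\sqrt{mK}\big)+\mathcal{O}(1/K)$.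
   Context: $\ell(\bm{x};\bm{s})$ is the loss of model parameters $\bm{x}\in\mathbb{R}^d$ on a data sample $\bm{s}$; $g_i(\bm{x};\xi)$ denotes the stochastic gradient of the loss at $\bm{x}$ evaluated on a mini-batch $\xi$ drawn from $\mathcal{D}_i$. $\|\cdot\|$ is the Euclidean norm. The expectation is over all the random mini-batches used by the algorithm. *)

(* Defs.v *)
From HB Require Import structures.
From mathcomp Require Import all_boot all_order all_algebra.
From mathcomp Require Import all_classical all_reals all_analysis.
Set Implicit Arguments. Unset Strict Implicit. Unset Printing Implicit Defensive.
Import Order.TTheory GRing.Theory Num.Theory.
Import numFieldNormedType.Exports.
Local Open Scope classical_set_scope.
Local Open Scope ring_scope.

Definition enorm {R : realType} {d : nat} (v : 'rV[R]_d) : R :=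
  Num.sqrt (\sum_(j < d) v 0 j ^+ 2).

Definition grad {R : realType} {d : nat} (f : 'rV[R]_d -> R) (x : 'rV[R]_d)
  : 'rV[R]_d := \row_(j < d) ('d f x (delta_mx 0 j : 'rV[R]_d)).

(* Identification of d.-tuples of reals (which carry the product Borel
   sigma-algebra in MathComp-Analysis) with row vectors. *)
Definition vec_of_tuple {R : realType} {d : nat} (t : d.-tuple R) : 'rV[R]_d :=
  \row_(j < d) tnth t j.

Definition mutually_independent {R : realType} {dO dX : measure_display}
  {O : measurableType dO} {Xi : measurableType dX} {I : eqType}
  (P : probability O R) (X : I -> O -> Xi) : Prop :=
  forall (J : seq I) (A : I -> set Xi),
    uniq J -> (forall j, j \in J -> measurable (A j)) ->
    P (\bigcap_(j in [set` J]) (X j @^-1` A j)) =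
    (\prod_(j <- J) P (X j @^-1` A j))%E.

(* Overlap-Local-SGD.  Given the realized mini-batches s k i (mini-batch of
   worker i at step k), the stochastic gradient oracles g i, the common
   initial point x0, returns (local models x_k^(i), anchor z_k). *)
Fixpoint olsgd {R : realType} {d m : nat} {Xi : Type}
  (g : 'I_m -> 'rV[R]_d -> Xi -> 'rV[R]_d) (gamma alpha : R) (tau : nat)
  (x0 : 'rV[R]_d) (s : nat -> 'I_m -> Xi) (k : nat)
  : ('I_m -> 'rV[R]_d) * 'rV[R]_d :=
  match k with
  | 0 => (fun _ => x0, x0)
  | k'.+1 =>
      let: (x, z) := olsgd g gamma alpha tau x0 s k' in
      let xh := fun i => x i - gamma *: g i (x i) (s k' i) in
      if (k'.+1 %% tau == 0)%N then
        let x' := fun i => xh i - alpha *: (xh i - z) in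
        (x', (m%:R)^-1 *: \sum_(i < m) x' i)
      else (xh, z)
  end.

Definition olsgd_y {R : realType} {d m : nat} {Xi : Type}
  (g : 'I_m -> 'rV[R]_d -> Xi -> 'rV[R]_d) (gamma alpha : R) (tau : nat)
  (x0 : 'rV[R]_d) (s : nat -> 'I_m -> Xi) (k : nat) : 'rV[R]_d :=
  let: (x, z) := olsgd g gamma alpha tau x0 s k in
  ((1 - alpha) / m%:R) *: \sum_(i < m) x i + alpha *: z.

(* Main.v *)
(* The averaged iterate y moves by plain stochastic steps,
   y_{k+1} = y_k - (1 - alpha) gamma (1/m) sum_i g_i, since the consensus matrix fixes
   the averaging weights.  Smoothness of F then gives a descent inequality whose error
   is L^2 times the disagreement V_k = (1/m) sum_i E |x_k^i - y_k|^2.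

   The differences x^i - y solve a linear recursion driven by the centred gradients and
   contracted by 1 - alpha at every synchronisation; they split into the response to
   the gradient noise and the response to the true local gradients.  The first is a
   martingale, so its second moment stays below
   gamma^2 sigma^2 (tau / ((2 - alpha) alpha) - 1).  The second is bounded pathwise: the
   l^2 gain of the recursion is at most tau / alpha, and its input is controlled by
   kappa^2, by V itself and by the mean gradient.  The condition K >= 60 m tau^2 / alpha^2
   makes the feedback through V a contraction and lets the mean gradient be absorbed by
   the negative term of the descent inequality.

   A fresh batch is independent of the sigma-algebra generated by all the other batches,
   so Fubini on the product law makes the noise orthogonal to everything measurable
   there. *)
Require Import Defs.
From HB Require Import structures.
From mathcomp Require Import all_boot all_order all_algebra.
From mathcomp Require Import all_classical all_reals all_analysis.
From mathcomp Require Import measurable_realfun ring lra.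
Import Order.TTheory GRing.Theory Num.Theory.
Import numFieldNormedType.Exports.
Set Implicit Arguments. Unset Strict Implicit. Unset Printing Implicit Defensive.
Local Open Scope classical_set_scope.
Local Open Scope ring_scope.

(** * Vectors, families and the consensus recursion *)

Section Euclidean.
Context {R : realFieldType} {d : nat}.
Implicit Types u v w : 'rV[R]_d.

Definition dot u v : R := \sum_(j < d) u 0 j * v 0 j.
Definition sqn u : R := dot u u.

Lemma dotC u v : dot u v = dot v u.
Proof. by apply: eq_bigr => j _; rewrite mulrC. Qed.

Lemma dotDl u v w : dot (u + v) w = dot u w + dot v w.
Proof. by rewrite -big_split; apply: eq_bigr => j _; rewrite mxE mulrDl. Qed.

Lemma dotZl a u v : dot (a *: u) v = a * dot u v.
Proof. by rewrite mulr_sumr; apply: eq_bigr => j _; rewrite mxE mulrA. Qed.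

Lemma dotDr u v w : dot w (u + v) = dot w u + dot w v.
Proof. by rewrite dotC dotDl !(dotC w). Qed.

Lemma dotZr a u v : dot u (a *: v) = a * dot u v.
Proof. by rewrite dotC dotZl dotC. Qed.

Lemma dot0l u : dot 0 u = 0.
Proof. by rewrite -(scale0r 0) dotZl mul0r. Qed.

Lemma dot_sumr I (r : seq I) (F : I -> 'rV[R]_d) u :
  dot u (\sum_(i <- r) F i) = \sum_(i <- r) dot u (F i).
Proof.
elim/big_ind2 : _ => [|x a y b <- <-|//]; first by rewrite dotC dot0l.
by rewrite dotDr.
Qed.

Lemma sqn_ge0 u : 0 <= sqn u.
Proof. by apply: sumr_ge0 => j _; rewrite -expr2 sqr_ge0. Qed.

Lemma coord_le_sqn u j : u 0 j ^+ 2 <= sqn u.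
Proof.
rewrite /sqn /dot (bigD1 j)//= expr2 lerDl sumr_ge0// => i _.
by rewrite -expr2 sqr_ge0.
Qed.

Lemma coordB_le_sqn u v j : (u 0 j - v 0 j) ^+ 2 <= sqn (u - v).
Proof. by have := coord_le_sqn (u - v) j; rewrite !mxE. Qed.

Lemma sqnD u v : sqn (u + v) = sqn u + 2 * dot u v + sqn v.
Proof. by rewrite /sqn !dotDl !dotDr (dotC v u); ring. Qed.

Lemma sqnZ a u : sqn (a *: u) = a ^+ 2 * sqn u.
Proof. by rewrite /sqn dotZl dotZr mulrA. Qed.

Lemma dot_young c u v : 0 < c -> 2 * dot u v <= c * sqn u + c^-1 * sqn v.
Proof.
move=> c0; have := sqn_ge0 (c *: u + - 1 *: v).
rewrite sqnD !sqnZ dotZl dotZr => h.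
rewrite -(ler_pM2l c0); apply: le_trans (_ : c ^+ 2 * sqn u + sqn v <= _).
  by lra.
by rewrite mulrDr mulVKf ?gt_eqF//; lra.
Qed.

Lemma sqnD_young c u v : 0 < c ->
  sqn (u + v) <= (1 + c) * sqn u + (1 + c^-1) * sqn v.
Proof. by move=> /(dot_young u v); rewrite sqnD; lra. Qed.

Lemma sqn_le_double u v : sqn v <= 2 * sqn u + 2 * sqn (v - u).
Proof.
have := @sqnD_young 1 u (v - u) ltr01.
by rewrite [u + _]addrC subrK invr1.
Qed.

Lemma sqnB_sum u v : sqn (u - v) = sqn u - 2 * dot u v + sqn v.
Proof. by rewrite -scaleN1r sqnD sqnZ dotZr; ring. Qed.

(* The descent inequality along the step [- p *: (Nb + Hb)], with the terms that
   are linear in the noise [Nb] set apart. *)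
Lemma descent_split (L p f0 f1 M : R) (gF Hb Nb : 'rV[R]_d) : 0 <= p ->
  f1 <= f0 + dot gF (- p *: (Nb + Hb)) + L / 2 * sqn (- p *: (Nb + Hb)) ->
  sqn (Hb - gF) <= M ->
  f1 <= f0 - p / 2 * (sqn gF + sqn Hb - M) + L / 2 * p ^+ 2 * (sqn Hb + sqn Nb)
    + (L * p ^+ 2 * dot Hb Nb - p * dot gF Nb).
Proof.
move=> p0 f10 hM; apply: le_trans f10 _.
have := ler_wpM2l p0 hM; rewrite sqnB_sum sqnZ sqrrN sqnD dotZr dotDr.
by rewrite (dotC Nb Hb) (dotC Hb gF); lra.
Qed.

End Euclidean.

Lemma enorm_sqr {R : realType} {d : nat} (v : 'rV[R]_d) : enorm v ^+ 2 = sqn v.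
Proof.
rewrite /enorm sqr_sqrtr; last by apply: sumr_ge0 => j _; exact: sqr_ge0.
by apply: eq_bigr => j _; rewrite expr2.
Qed.

(** * Averages and mean squares over the workers *)

Section Families.
Context {R : realFieldType} {d m : nat}.
Hypothesis m_gt0 : (0 < m)%N.
Implicit Types e f : 'I_m -> 'rV[R]_d.

Definition mean e : 'rV[R]_d := m%:R^-1 *: \sum_(i < m) e i.
Definition msq e : R := m%:R^-1 * \sum_(i < m) sqn (e i).

Let m_neq0 : m%:R != 0 :> R.
Proof. by rewrite pnatr_eq0 -lt0n. Qed.

Lemma msq_ge0 e : 0 <= msq e.
Proof. by rewrite mulr_ge0 ?invr_ge0// sumr_ge0// => i _; exact: sqn_ge0. Qed.

Lemma mean_cst u : mean (fun=> u) = u.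
Proof.
by rewrite /mean sumr_const card_ord -[u *+ m]scaler_nat scalerA mulVf// scale1r.
Qed.

Lemma msq_cst u : msq (fun=> u) = sqn u.
Proof.
by rewrite /msq sumr_const card_ord -[sqn u *+ m]mulr_natl mulrA mulVf// mul1r.
Qed.

Lemma meanD e f : mean (fun i => e i + f i) = mean e + mean f.
Proof. by rewrite /mean big_split scalerDr. Qed.

Lemma meanZ a e : mean (fun i => a *: e i) = a *: mean e.
Proof. by rewrite /mean -scaler_sumr !scalerA mulrC. Qed.

Lemma msqD_young c e f : 0 < c ->
  msq (fun i => e i + f i) <= (1 + c) * msq e + (1 + c^-1) * msq f.
Proof.
move=> c0; rewrite /msq !(mulrCA _ m%:R^-1) -mulrDr ler_wpM2l ?invr_ge0//.
by rewrite !mulr_sumr -big_split ler_sum// => i _; exact: sqnD_young.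
Qed.

Lemma msqZ a e : msq (fun i => a *: e i) = a ^+ 2 * msq e.
Proof.
rewrite /msq mulrCA; congr (_ * _); rewrite mulr_sumr.
by apply: eq_bigr => i _; rewrite sqnZ.
Qed.

(** Expanding the square works because the cross term only sees [mean e]. The case [t = 1] is the
    variance identity. The case [t = 1 - alpha] gives the factor [1 - alpha ^+ 2] in the input of
    the consensus recursion. *)
Lemma msq_shift t e :
  msq (fun i => e i - t *: mean e) = msq e - (2 * t - t ^+ 2) * sqn (mean e).
Proof.
have -> : msq (fun i => e i - t *: mean e) = msq e +
    (m%:R^-1 * \sum_(i < m) (- 2 * t * dot (mean e) (e i) + t ^+ 2 * sqn (mean e))).
  rewrite /msq -mulrDr -big_split; congr (_ * _); apply: eq_bigr => i _.
  by rewrite sqnB_sum sqnZ dotZr dotC /=; ring.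
rewrite big_split /= sumr_const card_ord -mulr_sumr -dot_sumr.
have -> : \sum_(i < m) e i = m%:R *: mean e by rewrite scalerA divff// scale1r.
by rewrite dotZr -/(sqn _) -mulr_natl; field.
Qed.

Lemma sqn_mean_le e : sqn (mean e) <= msq e.
Proof.
by rewrite -subr_ge0; have := msq_ge0 (fun i => e i - 1 *: mean e);
  rewrite msq_shift; lra.
Qed.

Lemma msqD e f : msq (fun i => e i + f i) =
  msq e + 2 * (m%:R^-1 * \sum_(i < m) dot (e i) (f i)) + msq f.
Proof.
have -> : msq (fun i => e i + f i) = m%:R^-1 *
    (\sum_(i < m) sqn (e i) + 2 * (\sum_(i < m) dot (e i) (f i)) +
     \sum_(i < m) sqn (f i)).
  rewrite mulr_sumr -!big_split /msq; congr (_ * _).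
  by apply: eq_bigr => i _; rewrite sqnD.
by rewrite /msq; ring.
Qed.

Lemma msq_le_scale c e f :
  (forall i, sqn (e i) <= c * sqn (f i)) -> msq e <= c * msq f.
Proof.
move=> ef; rewrite /msq mulrCA ler_wpM2l ?invr_ge0// mulr_sumr.
by apply: ler_sum => i _.
Qed.

Lemma msq_centred e : msq (fun i => e i - mean e) = msq e - sqn (mean e).
Proof.
have := msq_shift 1 e; under eq_fun do rewrite scale1r.
by move=> ->; ring.
Qed.

(** Write [e = f + r] and centre both parts. Centring is an orthogonal projection, so it cannot
    increase the mean square of [r]. *)
Lemma msq_centred_young c e f : 0 < c -> msq (fun i => e i - mean e) <=
  (1 + c) * msq (fun i => f i - mean f) + (1 + c^-1) * msq (fun i => e i - f i).
Proof.
move=> c0; pose r i := e i - f i.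
have meanE : mean e = mean f + mean r.
  by rewrite -meanD; congr mean; apply/funext => i; rewrite addrC subrK.
have -> : (fun i => e i - mean e) =
    (fun i => (f i - mean f) + (r i - mean r)).
  by apply/funext => i; rewrite meanE opprD addrACA /r [f i + _]addrC subrK.
apply: le_trans (msqD_young _ _ c0) _.
rewrite lerD2l ler_wpM2l//; first by rewrite addr_ge0// invr_ge0 ltW.
by rewrite msq_centred lerBlDr lerDl sqn_ge0.
Qed.

(** The left side is the variance of [e] plus [a ^+ 2 * sqn (mean e)]. The variance is compared with
    that of [f] by Young with [c = 1 / 4]. In the application [e] holds the gradients at the local
    models and [f] those at the common point [y]. *)
Lemma msq_shrunk_le a e f M1 M2 : msq (fun i => f i - mean f) <= M1 ->
  msq (fun i => e i - f i) <= M2 ->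
  msq e - (1 - a ^+ 2) * sqn (mean e) <=
    5 / 4 * M1 + 5 * M2 + a ^+ 2 * sqn (mean e).
Proof.
move=> fM efM; have c0 : (0 : R) < 1 / 4 by rewrite divr_gt0.
have := msq_centred_young e f c0; rewrite msq_centred.
have -> : 1 + (1 / 4)^-1 = 5 :> R by field.
by lra.
Qed.

End Families.

(** * The linear consensus recursion and its gain *)

Section LinearRecursion.
Context {R : realFieldType} {d m : nat}.
Variables (alpha : R) (tau : nat).
Hypotheses (m_gt0 : (0 < m)%N) (tau_gt0 : (0 < tau)%N) (alpha01 : 0 < alpha < 1).
Let alpha_gt0 : 0 < alpha. Proof. by case/andP: alpha01. Qed.
Let alpha_lt1 : alpha < 1. Proof. by case/andP: alpha01. Qed.
Implicit Types inp : nat -> 'I_m -> 'rV[R]_d.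

(* The differences [x^i - y] obey this recursion: a synchronisation ([b = true])
   removes their mean and multiplies them by [1 - alpha]. *)
Definition pull (b : bool) (e : 'I_m -> 'rV[R]_d) (i : 'I_m) : 'rV[R]_d :=
  if b then (1 - alpha) *: (e i - mean e) else e i.

Fixpoint deviation inp (k : nat) : 'I_m -> 'rV[R]_d :=
  if k is k'.+1 then
    pull (k %% tau == 0)%N (fun i => deviation inp k' i + inp k' i)
  else fun=> 0.

Lemma deviationD f g k i : deviation (fun k i => f k i + g k i) k i =
  deviation f k i + deviation g k i.
Proof.
elim: k i => [|k IH] i /=; first by rewrite addr0.
under eq_fun do rewrite IH addrACA.
case: (_ == _) => //; rewrite /pull -scalerDr; congr (_ *: _).
rewrite (meanD (fun i => deviation f k i + f k i)) opprD.
exact: addrACA.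
Qed.

Let rate (b : bool) : R := if b then 1 - alpha else 1.

Lemma msq_pull b e : msq (pull b e) <= rate b ^+ 2 * msq e.
Proof.
case: b; rewrite /pull /rate/= ?expr1n ?mul1r// msqZ.
rewrite ler_wpM2l ?sqr_ge0//.
have := msq_shift m_gt0 1 e; under eq_fun do rewrite scale1r.
by move=> ->; have := sqn_ge0 (mean e); lra.
Qed.

(** Either the residue wraps from [tau - 1] to 0, which is a synchronisation, or it grows by one.
    Stated over [R], it turns the recursions below into field identities. *)
Lemma modnS_cases k :
  ((k.+1 %% tau == 0)%N /\ (k.+1 %% tau = 0)%N /\ (k %% tau)%:R = tau%:R - 1 :> R) \/
  ((k.+1 %% tau == 0)%N = false /\ (k.+1 %% tau)%:R = (k %% tau)%:R + 1 :> R).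
Proof.
rewrite modnS /dvdn; case: ifP => [|_]; last by right; split=> //; rewrite -natr1.
move=> /eqP h; left; split => //; split => //.
suff {2}<- : ((k %% tau).+1 = tau)%N by rewrite -natr1 addrK.
have : (tau %| k.+1)%N by rewrite /dvdn h.
rewrite {1}(divn_eq k tau) -addnS dvdn_addr ?dvdn_mull// => /dvdn_leq -/(_ isT) le.
by apply/eqP; rewrite eqn_leq le ltn_pmod.
Qed.

Let tau_le k : (k %% tau)%:R <= tau%:R - 1 :> R.
Proof. by rewrite lerBrDr natr1 ler_nat ltn_pmod. Qed.

Section gain.
Variable inp : nat -> 'I_m -> 'rV[R]_d.

(** The periodic solution of [massS]: just after a synchronisation, [tau * (1 - alpha) / alpha]
    reproduces itself over one period. Starting there rather than at 0 keeps [mass] positive, hence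
    invertible. *)
Let mass k : R := tau%:R * (1 - alpha) / alpha + (k %% tau)%:R.
(** The dual quantity: the total response, from step [k] onwards, to a unit state at step [k], a
    geometric series over the periods. *)
Let weight k : R := tau%:R / alpha - (k %% tau)%:R.

Let Fixpoint weighted k : R :=
  if k is k'.+1 then rate (k %% tau == 0)%N * (weighted k' + msq (inp k')) else 0.

Let rate_ge0 b : 0 <= rate b.
Proof. by case: b; rewrite /rate//=; have := alpha_lt1; lra. Qed.

Let weighted_ge0 k : 0 <= weighted k.
Proof. by elim: k => //= k IH; rewrite mulr_ge0// addr_ge0// msq_ge0. Qed.

Let tau1 : 1 <= tau%:R :> R.
Proof. by rewrite ler1n. Qed.

Let mass_gt0 k : 0 < mass k.
Proof.
by rewrite ltr_wpDr// divr_gt0 ?mulr_gt0 ?ltr0n ?subr_gt0.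
Qed.

Let massS k : mass k.+1 = rate (k.+1 %% tau == 0)%N * (mass k + 1).
Proof.
rewrite /mass /rate; have a0 : alpha != 0 by rewrite gt_eqF.
by have [[-> [-> ->]]|[-> ->]] := modnS_cases k => /=; [field|ring].
Qed.

Let weightS k : rate (k.+1 %% tau == 0)%N * weight k.+1 = weight k - 1.
Proof.
rewrite /weight /rate; have a0 : alpha != 0 by rewrite gt_eqF.
by have [[-> [-> ->]]|[-> ->]] := modnS_cases k => /=; [field|ring].
Qed.

Let tau_alpha : tau%:R <= tau%:R / alpha :> R.
Proof. by rewrite ler_pdivlMr// ler_piMr// ltW. Qed.

Let mass_le k : mass k <= tau%:R / alpha.
Proof.
have -> : tau%:R / alpha = tau%:R * (1 - alpha) / alpha + tau%:R :> R.
  by field; rewrite gt_eqF.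
by rewrite lerD2l; have := tau_le k; lra.
Qed.

Let weight_ge0 k : 0 <= weight k.
Proof. by have := tau_le k; have := tau_alpha; rewrite /weight; lra. Qed.

(* Weighted Cauchy-Schwarz: [mass k] is the total weight of the past inputs in
   [deviation inp k], and [weighted k] the weighted sum of their squares. *)
Let deviation_le k : msq (deviation inp k) <= mass k * weighted k.
Proof.
elim: k => [|k IH].
  rewrite /= /msq big1 ?mulr0// => i _; exact: dot0l.
rewrite [deviation _ _]/= [weighted _]/= massS.
apply: (le_trans (msq_pull _ _)); set a := rate _.
rewrite (_ : a * (mass k + 1) * (a * _) =
   a ^+ 2 * ((mass k + 1) * (weighted k + msq (inp k)))); last by ring.
rewrite ler_wpM2l ?sqr_ge0//.
(* With Young constant [c = 1 / mass k], both [(1 + c) * mass k] and the factor of the new input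
   equal [mass k + 1]. *)
have := @msqD_young _ _ _ (mass k)^-1 (deviation inp k) (inp k).
rewrite invr_gt0 mass_gt0 invrK => /(_ isT) /le_trans; apply.
have M0 := mass_gt0 k; have Mi0 : 0 < (mass k)^-1 by rewrite invr_gt0.
have : (1 + (mass k)^-1) * msq (deviation inp k) <=
    (1 + (mass k)^-1) * (mass k * weighted k) by rewrite ler_wpM2l//; lra.
rewrite (_ : (1 + _^-1) * (mass k * _) = (mass k + 1) * weighted k); last first.
  by field; rewrite gt_eqF.
by lra.
Qed.

(** Potential argument: [weight K * weighted K] is what the accumulated squares contribute from step
    [K] on. By [weightS] each step moves exactly [weighted] from the potential into the sum, and a
    new input enters with weight at most [tau / alpha]. *)
Let sum_weighted K : \sum_(k < K) weighted k + weight K * weighted K <=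
  tau%:R / alpha * \sum_(k < K) msq (inp k).
Proof.
elim: K => [|K IH]; first by rewrite !big_ord0 /=; lra.
rewrite !big_ord_recr [weighted K.+1]/= [rate _ * _]mulrC [weight _ * _]mulrCA.
rewrite [weight _ * rate _]mulrC weightS.
have : weight K * msq (inp K) <= tau%:R / alpha * msq (inp K).
  by rewrite ler_wpM2r ?msq_ge0// /weight lerBlDr lerDl.
have := msq_ge0 (inp K); move: IH => /=; nra.
Qed.

(* Schur test: the rows ([mass]) and the columns ([weight]) of the kernel expressing
   the deviations in terms of the inputs both sum to at most [tau / alpha]. *)
Lemma deviation_gain K : \sum_(k < K) msq (deviation inp k) <=
  (tau%:R / alpha) ^+ 2 * \sum_(k < K) msq (inp k).
Proof.
have ta0 : 0 <= tau%:R / alpha :> R by have := tau_alpha; have := tau1; lra.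
rewrite expr2 -mulrA; apply: (@le_trans _ _ (tau%:R / alpha * \sum_(k < K) weighted k)).
  rewrite mulr_sumr ler_sum// => k _; apply: (le_trans (deviation_le k)).
  by rewrite ler_wpM2r.
rewrite ler_wpM2l//; apply: le_trans (sum_weighted K).
by rewrite lerDl mulr_ge0.
Qed.

End gain.

End LinearRecursion.

(** * Smooth functions *)

Section Smoothness.
Context {R : realType} {d : nat}.
Implicit Types (F : 'rV[R]_d -> R) (x v : 'rV[R]_d).

Lemma diff_grad F x v : 'd F x v = dot (grad F x) v.
Proof.
rewrite {1}(row_sum_delta v) linear_sum.
by apply: eq_bigr => j _; rewrite linearZ mxE mulrC.
Qed.

Lemma grad_mean m (F : 'I_m -> 'rV[R]_d -> R) x :
  (forall i, differentiable (F i) x) ->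
  grad (fun y => m%:R^-1 * \sum_(i < m) F i y) x = mean (fun i => grad (F i) x).
Proof.
move=> dF; apply/rowP => j; rewrite !mxE summxE.
have -> : (fun y => m%:R^-1 * \sum_(i < m) F i y) = m%:R^-1 \*: (\sum_(i < m) F i).
  by apply/funext => y; rewrite fct_sumE.
rewrite -deriveE; last exact/differentiableZ/differentiable_sum.
have dvF i : derivable (F i) x (delta_mx 0 j) by exact: diff_derivable.
rewrite deriveZ ?derive_sum//; last exact: derivable_sum.
by congr (_ * _); apply: eq_bigr => i _; rewrite mxE deriveE.
Qed.

(** Cauchy-Schwarz in a form without square roots, from Young with constant [1 / c]. *)
Lemma dot_le c u v : 0 < c -> sqn u <= c ^+ 2 * sqn v -> dot u v <= c * sqn v.
Proof.
move=> c0 uv; have ci0 : 0 < c^-1 by rewrite invr_gt0.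
have := dot_young u v ci0; rewrite invrK => h.
suff : c^-1 * sqn u <= c * sqn v by lra.
by rewrite ler_pdivrMl// mulrA -expr2.
Qed.

(** On the segment from [x] to [x + v], the function [psi] subtracts the claimed quadratic growth
    from [F]. The Lipschitz gradient makes its derivative nonpositive on the open unit interval, so
    the endpoint values compare without any integration. *)
Lemma smooth_upper_bound F L : 0 < L ->
  (forall x, differentiable F x) ->
  (forall x y, sqn (grad F x - grad F y) <= L ^+ 2 * sqn (x - y)) ->
  forall x v, F (x + v) <= F x + dot (grad F x) v + L / 2 * sqn v.
Proof.
move=> L0 dF lipF x v.
pose l : R -> 'rV[R]_d := *:%R^~ v + cst x.
pose a := dot (grad F x) v; pose b := L / 2 * sqn v.
pose psi : R -> R := F \o l - (id * cst a + cst b * (id ^+ 2)).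
have dl (t : R) : is_diff t l ( *:%R^~ v + 0) by exact: is_diffD.
have dFl (t : R) : is_derive t 1 (F \o l) (dot (grad F (l t)) v).
  have dFl : differentiable (F \o l) t.
    by apply: differentiable_comp => //; exact: ex_diff.
  apply: DeriveDef; first exact/derivable1_diffP.
  have dlt : differentiable l t by exact: ex_diff.
  rewrite deriveE// diff_comp//.
  by rewrite /= diff_val/= addr0 scale1r diff_grad.
have dpsi (t : R) : is_derive t 1 psi (dot (grad F (l t)) v - (a + b * (2 * t))).
  have did : is_derive t (1 : R) (id : R -> R) 1 by exact: is_derive_id.
  have dq := is_deriveD (is_deriveM did (is_derive_cst a t 1))
    (is_deriveM (is_derive_cst b t 1) (is_deriveX 2 did)).
  have dB := is_deriveB (dFl t) dq.
  rewrite [psi]/(F \o l - (id * cst a + cst b * id ^+ 2)).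
  apply: (is_derive_eq dB).
  rewrite /= /cst /= !scaler0 add0r addr0 expr1 /GRing.scale /= !mulr1.
  by [].
have : psi 1 <= psi 0.
  apply: (@ler0_derive1_nincr R psi 0 1) => //.
  - move=> t t01; rewrite derive1E derive_val.
    have /andP[t0 t1] : 0 < t < 1 by move: t01; rewrite in_itv.
    have ltx : l t - x = t *: v by rewrite /l /= addrK.
    (* At time [t] the point has moved by [t *: v], so the gradient has changed by at most [L * t]
       times the length of [v]. *)
    have := @dot_le (L * t) (grad F (l t) - grad F x) v (mulr_gt0 L0 t0).
    have -> : (L * t) ^+ 2 * sqn v = L ^+ 2 * sqn (l t - x).
      by rewrite ltx sqnZ; ring.
    move=> /(_ (lipF _ _)).
    have -> : dot (grad F (l t) - grad F x) v = dot (grad F (l t)) v - a.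
      by rewrite -(scaleN1r (grad F x)) dotDl dotZl mulN1r.
    by rewrite /b; move: (dot _ v) (sqn v) (a) => {}c s a'; clear; lra.
  - apply: continuous_subspaceT => t; apply: differentiable_continuous.
    exact/derivable1_diffP.
have psiE t : psi t = F (t *: v + x) - (t * a + b * t ^+ 2) by [].
rewrite !psiE scale1r scale0r add0r [v + x]addrC /b -/a.
by move: (F _) (F _) (sqn v) (a) => p q s a'; clear; lra.
Qed.

End Smoothness.

(** * Measurability and fresh batches *)

Section ContinuousMeasurable.
Context {R : realType} {d : nat}.

Let grid (n : nat) (t : d.-tuple R) : d.-tuple int :=
  [tuple Num.floor (n.+1%:R * tnth t j) | j < d].

Let grid_point (n : nat) (c : d.-tuple int) : 'rV[R]_d :=
  \row_(j < d) ((tnth c j)%:~R / n.+1%:R).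

Let measurable_grid n c : measurable (grid n @^-1` [set c]).
Proof.
have -> : grid n @^-1` [set c] =
    \bigcap_(j in [set: 'I_d]) (fun t : d.-tuple R => tnth t j) @^-1`
       `[(tnth c j)%:~R / n.+1%:R, (tnth c j + 1)%:~R / n.+1%:R[%classic.
  have n0 : (0 : R) < n.+1%:R by rewrite ltr0n.
  apply/seteqP; split => t /=.
    move=> <- j _ /=; rewrite tnth_mktuple in_itv/= ler_pdivrMr// ltr_pdivlMr//.
    by rewrite mulrC ge_floor/= mulrC floorD1_gt.
  move=> tc; apply: eq_from_tnth => j; rewrite tnth_mktuple.
  have /= := tc j I; rewrite in_itv/= ler_pdivrMr// ltr_pdivlMr// mulrC => h.
  exact: floor_def.
apply: fin_bigcap_measurable => // j _.
by rewrite -[X in measurable X]setTI; apply: measurable_tnth.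
Qed.

(* [f] is the pointwise limit of the step functions obtained by rounding the
   coordinates down to multiples of [1 / n]. *)
Lemma continuous_measurable_tuple (f : 'rV[R]_d -> R) : continuous f ->
  measurable_fun [set: d.-tuple R] (f \o vec_of_tuple).
Proof.
move=> cf.
apply: (@measurable_fun_cvg _ _ _ _ (fun n t => f (grid_point n (grid n t)))).
  move=> n _ B mB; rewrite setTI.
  (* The rounded point takes countably many values, so the preimage is a countable union of
     measurable cells. *)
  rewrite (_ : _ @^-1` _ = \bigcup_c
     (if f (grid_point n c) \in B then grid n @^-1` [set c] else set0)).
    apply: countable_bigcupT_measurable => // c; first by case: ifP.
  apply/seteqP; split => [t /= Bt|t [c _]].
    by exists (grid n t) => //; rewrite mem_set.
  by case: ifPn => // /set_mem Bc /= ->.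
move=> t _.
apply: continuous_cvg; first exact: cf.
apply/cvgrPdist_le => e e0.
near=> n; have n0 : (0 : R) < n.+1%:R by rewrite ltr0n.
apply: (@le_trans _ _ n.+1%:R^-1); last first.
  by apply/ltW; near: n; exact: (near_infty_natSinv_lt (PosNum e0)).
(* The norm of a row vector is the maximum over its coordinates, so it suffices to bound the
   rounding error of each one. *)
rewrite [leLHS]/Num.Def.normr/= mx_normrE.
apply: bigmax_le => [|[i0 j] _]; first by rewrite invr_ge0.
rewrite !mxE tnth_mktuple /= ger0_norm; last first.
  by rewrite subr_ge0 ler_pdivrMr// mulrC floor_le.
rewrite lerBlDr -(ler_pM2l n0) mulrDr divff ?gt_eqF// mulrCA divff ?gt_eqF// mulr1.
rewrite addrC -[1]/(1%:~R) -intrD; exact/ltW/floorD1_gt.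
Unshelve. all: by end_near. Qed.

End ContinuousMeasurable.

(** * Independence of one batch from all the others *)

Section Freshness.
Context {R : realType} {dO dX : measure_display} {O : measurableType dO}
  {Xi : measurableType dX} {I : eqType} (P : probability O R) (X : I -> O -> Xi).
Hypotheses (mX : forall i, measurable_fun setT (X i))
  (indepX : mutually_independent P X).

(* A pi-system generating the sigma-algebra of all the [X i] with [i != q]. *)
Definition cylinders_off (q : I) : set_system O :=
  [set B | exists (J : seq I) (A : I -> set Xi),
    [/\ uniq J, q \notin J, forall j, j \in J -> measurable (A j) &
        B = \bigcap_(j in [set` J]) (X j @^-1` A j)]].

Let measurable_preim i A : measurable A -> measurable (X i @^-1` A).
Proof. by move=> mA; rewrite -[X in measurable X]setTI; exact: mX. Qed.

Lemma cylinders_off_measurable q : cylinders_off q `<=` measurable.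
Proof.
move=> _ [J [A [_ _ mA ->]]]; apply: fin_bigcap_measurable => // j jJ.
exact/measurable_preim/mA.
Qed.

Lemma cylinders_off_setI q : setI_closed (cylinders_off q).
Proof.
move=> _ _ [J [A [uJ qJ mA ->]]] [J' [A' [uJ' qJ' mA' ->]]].
(* An index missing from one of the two lists is constrained there only by the full set. *)
exists (undup (J ++ J')), (fun j => (if j \in J then A j else setT) `&`
  (if j \in J' then A' j else setT)); split; first exact: undup_uniq.
- by rewrite mem_undup mem_cat negb_or qJ.
- move=> j _; apply: measurableI; case: ifP => // ?; [exact: mA|exact: mA'].
- apply/seteqP; split => [w [h h'] j _|w h]; rewrite /preimage/=.
    by split; case: ifP => // jJ; [exact: h|exact: h'].
  split => j jJ; have := h j; rewrite /= mem_undup mem_cat.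
    by move: jJ; rewrite /= => -> /(_ isT)[].
  by move: jJ; rewrite /= => -> /= ; rewrite orbT => /(_ isT)[].
Qed.

Lemma cylinders_offE q j A : j != q -> measurable A -> cylinders_off q (X j @^-1` A).
Proof.
move=> jq mA; exists [:: j], (fun=> A); split => //.
  by rewrite inE eq_sym.
apply/seteqP; split => [w Aw k /=|w /(_ j)]; first by rewrite inE => /eqP ->.
by apply; rewrite /= inE.
Qed.

Lemma cylinders_off_setT q : cylinders_off q setT.
Proof.
by exists [::], (fun=> setT); split => //; apply/seteqP; split.
Qed.

(** For fixed [A], both sides are finite measures in [B]. They agree on the pi-system of cylinders
    by mutual independence, hence on the sigma-algebra it generates. *)
Lemma fresh_indep q (B : set O) (A : set Xi) : <<s cylinders_off q >> B ->
  measurable A -> P (B `&` X q @^-1` A) = (P B * P (X q @^-1` A))%E.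
Proof.
move=> sB mA; have mE := measurable_preim q mA; set E := X q @^-1` A in mE *.
have Ep : P E \is a fin_num by exact: fin_num_measure.
pose r : {nonneg R} := NngNum (fine_ge0 (measure_ge0 P E)).
have rE : r%:num%:E = P E by exact: fineK.
suff : mrestr P mE B = mscale r P B by rewrite /mrestr /mscale rE muleC.
apply: (@g_sigma_algebra_measure_unique _ _ _ (cylinders_off q) _ (fun=> setT)) => //.
- exact: cylinders_off_measurable.
- by move=> _; exact: cylinders_off_setT.
- by rewrite bigcup_const.
- exact: cylinders_off_setI.
- move=> _ [J [C [uJ qJ mC ->]]]; rewrite /= /mrestr /mscale rE.
  (* Prescribing [A] at [q] and [C] elsewhere makes the intersection a cylinder over [q :: J], to
     which independence applies. *)
  pose C' j := if j == q then A else C j.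
  have C'q : C' q = A by rewrite /C' eqxx.
  have /= := indepX (J := q :: J) (A := C'); rewrite qJ uJ big_cons C'q.
  have C'E j : j \in J -> C' j = C j.
    by move=> jJ; rewrite /C'; case: eqP qJ => // <-; rewrite jJ.
  rewrite big_seq (eq_bigr (fun j => P (X j @^-1` C j))); last first.
    by move=> j jJ; rewrite C'E.
  rewrite -big_seq -indepX// => <-.
    congr (P _); apply/seteqP; split => w /=.
      move=> [h Ew] j /=; rewrite inE => /predU1P[->|jJ]; first by rewrite C'q.
      by rewrite C'E//; exact: h.
    move=> h; split; last by have := h q; rewrite C'q /= inE eqxx; exact.
    by move=> j /= jJ; have := h j; rewrite /= inE C'E// jJ orbT; exact.
    by [].
  move=> j; rewrite inE => /predU1P[->|jJ]; first by rewrite C'q.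
  by rewrite C'E//; exact: mC.
- by move=> _; rewrite /= /mrestr setTI (le_lt_trans (probability_le1 P mE))// ltry.
Qed.


Section Fubini.
Context {dT : measure_display} {T : measurableType dT} (q : I) (D : probability Xi R).
Hypothesis lawX : forall A, measurable A -> P (X q @^-1` A) = D A.
Variable H : O -> T.
Hypothesis mH : measurable_fun setT
  (H : g_sigma_algebraType (cylinders_off q) -> T).

Let sub_mH : measurable_fun setT H.
Proof.
move=> _ A mA; rewrite setTI.
have : <<s cylinders_off q >> (H @^-1` A) by rewrite -[_ @^-1` _]setTI; exact: mH.
apply: smallest_sub; first exact: sigma_algebra_measurable.
exact: cylinders_off_measurable.
Qed.

Let HX w := (H w, X q w).

Let mHX : measurable_fun setT HX.
Proof. exact: measurable_fun_pair. Qed.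

HB.instance Definition _ := isMeasurableFun.Build _ _ _ _ H sub_mH.
HB.instance Definition _ := isMeasurableFun.Build _ _ _ _ HX mHX.

Let law_pair (A : set (T * Xi)) : measurable A ->
  (distribution P H \x D)%E A = distribution P HX A.
Proof.
apply: product_measure_unique => B C mB mC.
rewrite /distribution /pushforward /= -lawX//.
by rewrite -fresh_indep// -[_ @^-1` _]setTI; exact: mH.
Qed.

(** [H] depends only on the other batches, so the joint law of [H] and [X q] is a product by
    [law_pair], and the fresh batch can be integrated out with [H] frozen. *)
Lemma fresh_tonelli (f : T * Xi -> \bar R) :
  measurable_fun setT f -> (forall p, 0 <= f p)%E ->
  (\int[P]_w f (H w, X q w) = \int[P]_w \int[D]_s f (H w, s))%E.
Proof.
move=> mf f0.
rewrite -(ge0_integral_distribution HX mf f0).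
rewrite (eq_measure_integral (distribution P H \x D)%E); last first.
  by move=> A mA _; exact/esym/law_pair.
rewrite fubini_tonelli1// ge0_integral_distribution//.
- exact: measurable_fun_fubini_tonelli_F.
- by move=> y; exact: integral_ge0.
Qed.

(** The signed version, needed for the cross terms; integrability passes to the product measure
    through [law_pair]. *)
Lemma fresh_fubini (f : T * Xi -> \bar R) :
  measurable_fun setT f -> P.-integrable setT (fun w => f (H w, X q w)) ->
  (\int[P]_w f (H w, X q w) = \int[P]_w \int[D]_s f (H w, s))%E.
Proof.
move=> mf intf.
have intHX : (distribution P H \x D)%E.-integrable setT f.
  apply/integrableP; split => //.
  rewrite (eq_measure_integral (distribution P HX)).
    rewrite ge0_integral_distribution//; last exact: measurableT_comp.
    by case/integrableP : intf.
  by move=> A mA _; exact: law_pair.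
rewrite -(@integral_distribution _ _ _ _ _ P HX f mf intf).
rewrite (eq_measure_integral (distribution P H \x D)%E); last first.
  by move=> A mA _; exact/esym/law_pair.
rewrite -integral12_prod_meas1// integral_distribution//.
  exact: (measurable_fubini_F intHX).
have mF := measurable_fubini_F intHX.
have /integrableP[_] := integrable_fubini_F intHX.
rewrite ge0_integral_distribution//; last exact: measurableT_comp.
move=> Foo; apply/integrableP; split => //.
exact: (measurableT_comp mF).
Qed.

End Fubini.

End Freshness.

(** * Measurable random vectors *)

Section MeasurableVectors.
Context {R : realType} {d : nat} {dO : measure_display} {O : measurableType dO}.
Implicit Types U V : O -> 'rV[R]_d.

Definition mvec V := forall j, measurable_fun setT (fun w => V w 0 j).

Lemma mvec_cst u : mvec (fun=> u).
Proof. by move=> j; exact: measurable_cst. Qed.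

Lemma mvecD U V : mvec U -> mvec V -> mvec (fun w => U w + V w).
Proof.
move=> mU mV j; under eq_fun do rewrite mxE.
exact: measurable_funD.
Qed.

Lemma mvecZ a V : mvec V -> mvec (fun w => a *: V w).
Proof. by move=> mV j; under eq_fun do rewrite mxE; exact: measurable_funM. Qed.

Lemma mvecB U V : mvec U -> mvec V -> mvec (fun w => U w - V w).
Proof.
by move=> mU mV; under eq_fun do rewrite -scaleN1r; exact/mvecD/mvecZ.
Qed.

Lemma mvec_sum I (r : seq I) (V : I -> O -> 'rV[R]_d) :
  (forall i, mvec (V i)) -> mvec (fun w => \sum_(i <- r) V i w).
Proof.
move=> mV; elim: r => [|i r IH].
  by under eq_fun do rewrite big_nil; exact: mvec_cst.
by under eq_fun do rewrite big_cons; exact: mvecD.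
Qed.

Lemma mvec_mean m (V : 'I_m -> O -> 'rV[R]_d) :
  (forall i, mvec (V i)) -> mvec (fun w => mean (V ^~ w)).
Proof. by move=> mV; apply: mvecZ; exact: mvec_sum. Qed.

Definition tuple_of_vec (v : 'rV[R]_d) : d.-tuple R := [tuple v 0 j | j < d].

Lemma tuple_of_vecK : cancel tuple_of_vec vec_of_tuple.
Proof. by move=> v; apply/rowP => j; rewrite mxE tnth_mktuple. Qed.

Lemma measurable_tuple_of_vec V : mvec V -> measurable_fun setT (tuple_of_vec \o V).
Proof.
move=> mV; apply/measurable_fun_tnthP => j.
by rewrite [X in measurable_fun _ X](_ : _ = fun w => V w 0 j)//;
  apply/funext => w; rewrite /= tnth_mktuple.
Qed.

Lemma mvec_comp (f : 'rV[R]_d -> R) V : measurable_fun setT (f \o vec_of_tuple) ->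
  mvec V -> measurable_fun setT (fun w => f (V w)).
Proof.
move=> mf /measurable_tuple_of_vec mV.
rewrite [X in measurable_fun _ X](_ : _ = (f \o vec_of_tuple) \o (tuple_of_vec \o V)).
  exact: measurableT_comp.
by apply/funext => w; rewrite /= tuple_of_vecK.
Qed.

(** Only inputs strictly before [k] enter the deviation at [k]. This is what later makes the
    accumulated noise measurable without the batches of step [k]. *)
Lemma mvec_deviation m alpha tau (inp : nat -> 'I_m -> O -> 'rV[R]_d) k i :
  (forall k' i, (k' < k)%N -> mvec (inp k' i)) ->
  mvec (fun w => deviation alpha tau (fun k i => inp k i w) k i).
Proof.
elim: k i => [|k IH] i minp; first exact: mvec_cst.
have mprev i' : mvec (fun w =>
    deviation alpha tau (fun k i => inp k i w) k i' + inp k i' w).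
  apply: mvecD; last exact: minp.
  by apply: IH => k' j lt; exact/minp/ltnW.
rewrite /= /pull; case: (_ == _) => //; apply: mvecZ; apply: mvecB => //.
exact: (@mvec_mean _ (fun i w => _)).
Qed.

End MeasurableVectors.

(** * Expectations and square-integrable random vectors *)

Section RealExpectation.
Context {R : realType} {dO : measure_display} {O : measurableType dO}
  (P : probability O R).
Implicit Types f g : O -> R.

Definition L1 f := P.-integrable setT (EFin \o f).

Lemma L1_le f g : measurable_fun setT f -> (forall w, `|f w| <= g w) -> L1 g -> L1 f.
Proof.
move=> mf fg; apply: le_integrable => //; first exact/measurable_EFinP.
by move=> w _; rewrite /= lee_fin (le_trans (fg w))// ler_norm.
Qed.

Lemma L1_cst c : L1 (fun=> c).
Proof. exact: finite_measure_integrable_cst. Qed.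

Lemma L1D f g : L1 f -> L1 g -> L1 (fun w => f w + g w).
Proof. exact: integrableD. Qed.

Lemma L1Z a f : L1 f -> L1 (fun w => a * f w).
Proof. exact: integrableZl. Qed.

Lemma L1B f g : L1 f -> L1 g -> L1 (fun w => f w - g w).
Proof.
by move=> If Ig; under eq_fun do rewrite -mulN1r; exact/L1D/L1Z.
Qed.

Lemma L1_sum I (r : seq I) (F : I -> O -> R) :
  (forall i, L1 (F i)) -> L1 (fun w => \sum_(i <- r) F i w).
Proof.
move=> IF; elim: r => [|i r IH].
  by under eq_fun do rewrite big_nil; exact: L1_cst.
by under eq_fun do rewrite big_cons; exact: L1D.
Qed.

Lemma ex_cst c : \int[P]_w c = c.
Proof. by rewrite Rintegral_cst//= [X in fine X](probability_setT P) mulr1. Qed.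

Lemma exD f g : L1 f -> L1 g ->
  \int[P]_w (f w + g w) = \int[P]_w f w + \int[P]_w g w.
Proof. exact: RintegralD. Qed.

Lemma exZ a f : L1 f -> \int[P]_w (a * f w) = a * \int[P]_w f w.
Proof. exact: RintegralZl. Qed.

Lemma exB f g : L1 f -> L1 g ->
  \int[P]_w (f w - g w) = \int[P]_w f w - \int[P]_w g w.
Proof. exact: RintegralB. Qed.

Lemma ex_comb_eq0 c e f g : L1 f -> L1 g -> \int[P]_w f w = 0 ->
  \int[P]_w g w = 0 -> \int[P]_w (c * f w - e * g w) = 0.
Proof.
move=> If Ig f0 g0; rewrite exB; [|exact: L1Z|exact: L1Z].
by rewrite !exZ// f0 g0 !mulr0 subr0.
Qed.

Lemma ex_sum I (r : seq I) (F : I -> O -> R) : (forall i, L1 (F i)) ->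
  \int[P]_w (\sum_(i <- r) F i w) = \sum_(i <- r) \int[P]_w F i w.
Proof.
move=> IF; elim: r => [|i r IH].
  by under eq_Rintegral do rewrite big_nil; rewrite ex_cst big_nil.
under eq_Rintegral do rewrite big_cons.
by rewrite exD ?IH ?big_cons//; exact: L1_sum.
Qed.

Lemma ex_le f g : L1 f -> L1 g -> (forall w, f w <= g w) ->
  \int[P]_w f w <= \int[P]_w g w.
Proof. by move=> If Ig fg; apply: le_Rintegral. Qed.

Definition L2 f := measurable_fun setT f /\ L1 (fun w => f w ^+ 2).

Lemma L2_le f g : measurable_fun setT f -> (forall w, f w ^+ 2 <= g w) -> L1 g -> L2 f.
Proof.
move=> mf fg Ig; split => //; apply: L1_le Ig => [|w].
  exact: measurable_funX.
by rewrite ger0_norm ?sqr_ge0.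
Qed.

Lemma L2_cst c : L2 (fun=> c).
Proof. by split; [exact: measurable_cst|exact: L1_cst]. Qed.

Lemma L2D f g : L2 f -> L2 g -> L2 (fun w => f w + g w).
Proof.
move=> [mf If] [mg Ig].
apply: (@L2_le _ (fun w => 2 * f w ^+ 2 + 2 * g w ^+ 2)).
- exact: measurable_funD.
- by move=> w; have := sqr_ge0 (f w - g w); rewrite sqrrB sqrrD; lra.
- by apply: L1D; exact: L1Z.
Qed.

Lemma L2Z a f : L2 f -> L2 (fun w => a * f w).
Proof.
move=> [mf If]; apply: (@L2_le _ (fun w => a ^+ 2 * f w ^+ 2)).
- exact: measurable_funM.
- by move=> w; rewrite exprMn.
- exact: L1Z.
Qed.

Lemma L2M f g : L2 f -> L2 g -> L1 (fun w => f w * g w).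
Proof.
move=> [mf If] [mg Ig].
apply: (@L1_le _ (fun w => f w ^+ 2 + g w ^+ 2)).
- exact: measurable_funM.
- move=> w; rewrite ler_norml; apply/andP; split.
    by have := sqr_ge0 (f w + g w); have := sqr_ge0 (f w);
      have := sqr_ge0 (g w); rewrite sqrrD; lra.
  by have := sqr_ge0 (f w - g w); have := sqr_ge0 (f w);
    have := sqr_ge0 (g w); rewrite sqrrB; lra.
- exact: L1D.
Qed.

Section Vectors.
Context {d : nat}.
Implicit Types U V : O -> 'rV[R]_d.

Definition L2v V := forall j, L2 (fun w => V w 0 j).

Lemma L2v_mvec V : L2v V -> mvec V.
Proof. by move=> LV j; case: (LV j). Qed.

Lemma L2v_cst u : L2v (fun=> u).
Proof. by move=> j; exact: L2_cst. Qed.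

Lemma L2vD U V : L2v U -> L2v V -> L2v (fun w => U w + V w).
Proof. by move=> LU LV j; under eq_fun do rewrite mxE; exact: L2D. Qed.

Lemma L2vZ a V : L2v V -> L2v (fun w => a *: V w).
Proof. by move=> LV j; under eq_fun do rewrite mxE; exact: L2Z. Qed.

Lemma L2vB U V : L2v U -> L2v V -> L2v (fun w => U w - V w).
Proof. by move=> LU LV; under eq_fun do rewrite -scaleN1r; exact/L2vD/L2vZ. Qed.

Lemma L2v_mean m (V : 'I_m -> O -> 'rV[R]_d) :
  (forall i, L2v (V i)) -> L2v (fun w => mean (V ^~ w)).
Proof.
move=> LV; apply: L2vZ; elim: (index_enum _) => [|i r IH].
  by under eq_fun do rewrite big_nil; exact: L2v_cst.
by under eq_fun do rewrite big_cons; exact: L2vD.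
Qed.

Lemma L2v_dot U V : L2v U -> L2v V -> L1 (fun w => dot (U w) (V w)).
Proof. by move=> LU LV; apply: L1_sum => j; exact: L2M. Qed.

Lemma L2v_sqn V : L2v V -> L1 (fun w => sqn (V w)).
Proof. by move=> LV; exact: L2v_dot. Qed.

Lemma L2v_msq m (V : 'I_m -> O -> 'rV[R]_d) :
  (forall i, L2v (V i)) -> L1 (fun w => msq (V ^~ w)).
Proof. by move=> LV; apply/L1Z/L1_sum => i; exact: L2v_sqn. Qed.

Lemma L2v_le V f : mvec V -> (forall w, sqn (V w) <= f w) -> L1 f -> L2v V.
Proof.
move=> mV Vf If j; apply: (L2_le (mV j)) If => w; apply: le_trans (Vf w).
exact: coord_le_sqn.
Qed.

Lemma L2v_deviation m alpha tau (inp : nat -> 'I_m -> O -> 'rV[R]_d) k i :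
  (forall k i, L2v (inp k i)) ->
  L2v (fun w => deviation alpha tau (fun k i => inp k i w) k i).
Proof.
move=> Linp; elim: k i => [|k IH] i; first exact: L2v_cst.
have Lprev i' : L2v (fun w =>
    deviation alpha tau (fun k i => inp k i w) k i' + inp k i' w) by exact: L2vD.
rewrite /= /pull; case: (_ == _) => //; apply: L2vZ; apply: L2vB => //.
exact: (@L2v_mean _ (fun i w => _)).
Qed.

End Vectors.

End RealExpectation.

(** * The Overlap-Local-SGD trajectory *)

Section Trajectory.
Context {R : realType} {d m : nat} {Xi : Type}.
Hypothesis m_gt0 : (0 < m)%N.
Variables (g : 'I_m -> 'rV[R]_d -> Xi -> 'rV[R]_d) (gamma alpha : R) (tau : nat)
  (x0 : 'rV[R]_d) (s : nat -> 'I_m -> Xi).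

Definition local_model k : 'I_m -> 'rV[R]_d :=
  (olsgd g gamma alpha tau x0 s k).1.
Definition anchor k : 'rV[R]_d := (olsgd g gamma alpha tau x0 s k).2.
Definition stoch_grad k (i : 'I_m) : 'rV[R]_d := g i (local_model k i) (s k i).

Lemma local_modelS k i : local_model k.+1 i =
  let xh := local_model k i - gamma *: stoch_grad k i in
  if (k.+1 %% tau == 0)%N then xh - alpha *: (xh - anchor k) else xh.
Proof.
rewrite /stoch_grad /local_model /anchor /=; case: (olsgd _ _ _ _ _ _ k) => x z.
by case: (_ == _).
Qed.

Lemma anchorS k : anchor k.+1 =
  if (k.+1 %% tau == 0)%N then mean (local_model k.+1) else anchor k.
Proof.
rewrite /local_model /anchor /=; case: (olsgd _ _ _ _ _ _ k) => x z.
by case: (_ == _).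
Qed.

Let y := olsgd_y g gamma alpha tau x0 s.

Lemma olsgd_yE k : y k = (1 - alpha) *: mean (local_model k) + alpha *: anchor k.
Proof.
rewrite /y /olsgd_y /local_model /anchor; case: (olsgd _ _ _ _ _ _ k) => x z /=.
by rewrite /mean scalerA.
Qed.

Lemma olsgd_y0 : y 0%N = x0.
Proof. by rewrite olsgd_yE /local_model/= mean_cst// -scalerDl subrK scale1r. Qed.

Let mean_half k : mean (fun i => local_model k i - gamma *: stoch_grad k i) =
  mean (local_model k) - gamma *: mean (stoch_grad k).
Proof.
rewrite -scaleNr -meanZ -meanD; congr mean.
by apply/funext => i; rewrite scaleNr.
Qed.

Lemma mean_local_modelS k : mean (local_model k.+1) =
  let xh := mean (local_model k) - gamma *: mean (stoch_grad k) in
  if (k.+1 %% tau == 0)%N then xh - alpha *: (xh - anchor k) else xh.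
Proof.
have -> : local_model k.+1 = fun i => local_model k.+1 i by [].
under eq_fun do rewrite local_modelS.
case: (_ == _) => /=; last exact: mean_half.
under eq_fun do rewrite -[- (alpha *: _)]scaleNr.
rewrite (meanD (fun i => local_model k i - gamma *: stoch_grad k i)) meanZ.
under [X in _ + - alpha *: mean X]eq_fun do rewrite -[- anchor k]scaleN1r.
rewrite (meanD (fun i => local_model k i - gamma *: stoch_grad k i)) meanZ.
by rewrite mean_half mean_cst// scaleN1r scaleNr.
Qed.

(** At a synchronisation the new anchor is the new mean, so [y k.+1] is that mean, [(1 - alpha)]
    times the half-step mean plus [alpha] times the old anchor. Off synchronisation the definition
    of [y] gives the same expression. *)
Lemma olsgd_yS k : y k.+1 = y k - ((1 - alpha) * gamma) *: mean (stoch_grad k).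
Proof.
rewrite !olsgd_yE anchorS mean_local_modelS /=; case: (_ == _) => /=;
  by apply/rowP => j; rewrite !mxE; ring.
Qed.

(** At a synchronisation the old anchor enters the local model and [y] with the same coefficient
    [alpha] and cancels. What remains is [1 - alpha] times the centred half-step models. *)
Lemma local_deviation k i : local_model k i - y k =
  deviation alpha tau (fun k i =>
    - gamma *: (stoch_grad k i - (1 - alpha) *: mean (stoch_grad k))) k i.
Proof.
pose inp k i :=
  - gamma *: (stoch_grad k i - (1 - alpha) *: mean (stoch_grad k)).
rewrite -/inp; elim: k i => [|k IH] i; first by rewrite olsgd_y0 subrr.
(* The half-step models are compared with the new [y], whose formula is the same in both
   branches. *)
have half i' : local_model k i' - gamma *: stoch_grad k i' - y k.+1 =
    deviation alpha tau inp k i' + inp k i'.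
  by rewrite -IH olsgd_yS; apply/rowP => j; rewrite !mxE; ring.
rewrite [RHS]/= /pull; under [X in mean X]eq_fun do rewrite -half -[- y _]scaleN1r.
rewrite -half.
rewrite (meanD (fun i => local_model k i - gamma *: stoch_grad k i)) meanZ mean_cst//.
rewrite mean_half olsgd_yE anchorS mean_local_modelS local_modelS.
by case: (_ == _) => /=; apply/rowP => j; rewrite !mxE; ring.
Qed.

End Trajectory.

(** * From summed descent inequalities to the explicit rate *)

Lemma replace_noise_bound (R : realFieldType) (f0 f1 X Y n s c : R) :
  f1 <= f0 - X + c * (Y + n) -> c * n <= c * s -> X <= f0 - f1 + c * (Y + s).
Proof. by lra. Qed.

Lemma sum_descent (R : realFieldType) (f a b v : nat -> R) (q l c s : R) K :
  (forall k, q * (a k + b k - l * v k) <= f k - f k.+1 + c * (b k + s)) ->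
  q * (\sum_(k < K) a k + \sum_(k < K) b k - l * \sum_(k < K) v k) <=
    f 0%N - f K + c * (\sum_(k < K) b k + K%:R * s).
Proof.
move=> h; elim: K => [|K IH].
  by rewrite !big_ord0; lra.
by rewrite !big_ord_recr /= -natr1; have := h K; lra.
Qed.

(* 7/2, 7/5 and 5/4, 5 are the Young constants 1 + c, 1 + 1/c for c = 5/2 and
   c = 1/4.  With [gamma L tau / alpha <= 1 / sqrt 60] they leave the disagreement
   the factor 60/53, and 60/53 * 7/2 <= 4, 60/53 * 7/4 <= 2. *)
Lemma rate_from_budget (R : rcfType) (m K t alpha gamma L s2 k2 : R)
    (f0 finf sA sB sV sN sD : R) :
  0 < m -> 0 < K -> 1 <= t -> 0 < alpha < 1 -> 0 < L ->
  0 <= s2 -> 0 <= k2 -> 0 <= sB -> 0 <= sV -> finf <= f0 ->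
  gamma = L^-1 * Num.sqrt (m / K) -> 60 * m * t ^+ 2 / alpha ^+ 2 <= K ->
  (1 - alpha) * gamma / 2 * (sA + sB - L ^+ 2 * sV) <=
    f0 - finf + L / 2 * ((1 - alpha) * gamma) ^+ 2 * (sB + K * (s2 / m)) ->
  sV <= 7 / 2 * sN + 7 / 5 * sD ->
  sN <= K * (gamma ^+ 2 * s2 * (t / ((2 - alpha) * alpha) - 1)) ->
  sD <= gamma ^+ 2 * (t / alpha) ^+ 2 *
    (5 / 4 * (K * k2) + 5 * L ^+ 2 * sV + alpha ^+ 2 * sB) ->
  K^-1 * sA <= 4 * L * (f0 - finf) / ((1 - alpha) * Num.sqrt (m * K))
    + 2 * (1 - alpha) * s2 / Num.sqrt (m * K)
    + 2 * m * s2 / K * (2 / ((2 - alpha) * alpha) * t - 1)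
    + 2 * m * t ^+ 2 * k2 / (alpha ^+ 2 * K).
Proof.
move=> m0 K0 t1 /andP[a0 a1] L0 s20 k20 sB0 sV0 ff gE hK h1 h2 h3 h4.
set r := Num.sqrt (m * K); have r0 : 0 < r by rewrite sqrtr_gt0 mulr_gt0.
have rr : r ^+ 2 = m * K by rewrite sqr_sqrtr// ltW// mulr_gt0.
have {gE} gE : gamma = r / (L * K).
  rewrite gE; have -> : m / K = (m * K) / K ^+ 2 by field; rewrite gt_eqF.
  rewrite sqrtrM ?(ltW (mulr_gt0 m0 K0))// sqrtrV ?sqr_ge0// sqrtr_sqr gtr0_norm//.
  by rewrite -/r; field; rewrite !gt_eqF.
have gL : gamma ^+ 2 = m / (K * L ^+ 2).
  by rewrite gE exprMn rr; field; rewrite !gt_eqF.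
(* This is the square of [gamma * L * t / alpha], the loop gain of the feedback through the
   disagreement. *)
pose rho := m * t ^+ 2 / (alpha ^+ 2 * K).
have [[[[m0' K0'] L0'] a0'] r0'] := (ltW m0, ltW K0, ltW L0, ltW a0, ltW r0).
have a1' : 0 <= 1 - alpha by rewrite subr_ge0 ltW.
have rho0 : 0 <= rho by rewrite divr_ge0// mulr_ge0// sqr_ge0.
have rho60 : rho <= 1 / 60.
  rewrite ler_pdivrMr ?mulr_gt0 ?exprn_gt0//.
  by move: hK; rewrite ler_pdivrMr ?exprn_gt0//; lra.
pose n0 := t / ((2 - alpha) * alpha) - 1.
have aa : 0 < (2 - alpha) * alpha by rewrite mulr_gt0//; lra.
have n00 : 0 <= n0.
  rewrite subr_ge0 ler_pdivlMr// mul1r; apply: le_trans t1.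
  by have := sqr_ge0 (1 - alpha); lra.
have L20 : 0 < L ^+ 2 by rewrite exprn_gt0.
pose v := L ^+ 2 * sV; have v0 : 0 <= v by rewrite mulr_ge0// sqr_ge0.
have hn : L ^+ 2 * sN <= m * s2 * n0.
  move: h3; rewrite -(ler_pM2l L20) gL => /le_trans; apply.
  by rewrite -/n0 le_eqVlt; apply/orP; left; apply/eqP; field; rewrite !gt_eqF.
have hd : L ^+ 2 * sD <= rho * (5 / 4 * (K * k2) + 5 * v + alpha ^+ 2 * sB).
  move: h4; rewrite -(ler_pM2l L20) gL => /le_trans; apply.
  rewrite /rho /v le_eqVlt; apply/orP; left; apply/eqP; field.
  by rewrite !gt_eqF.
have hv : v <= 7 / 2 * (L ^+ 2 * sN) + 7 / 5 * (L ^+ 2 * sD).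
  by move: h2; rewrite -(ler_pM2l L20) /v; lra.
have rv : rho * v <= 1 / 60 * v by rewrite ler_wpM2r.
have rB : rho * (alpha ^+ 2 * sB) <= 1 / 60 * sB.
  by rewrite ler_pM// ?mulr_ge0 ?sqr_ge0// ler_piMl// expr_le1// ltW.
have kb := mulr_ge0 rho0 (mulr_ge0 K0' k20).
have nb := mulr_ge0 (mulr_ge0 m0' s20) n00.
(* Feedback returns [7 / 5 * 5 / 60 = 7 / 60] of [v], leaving [53 / 60] on the left. The resulting
   coefficient of [sB], 7 / 265, is far below 1 / 2. *)
have {rv rB hv hd hn kb nb} hv : v <= 4 * (m * s2 * n0) + 2 * (rho * (K * k2)) + sB / 2.
  have {}hd : L ^+ 2 * sD <=
      5 / 4 * (rho * (K * k2)) + 5 * (rho * v) + rho * (alpha ^+ 2 * sB).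
    by apply: le_trans hd _; rewrite le_eqVlt; apply/orP; left; apply/eqP; ring.
  have combine (x n e q b M c : R) : x <= 7 / 2 * n + 7 / 5 * e -> n <= M ->
    e <= 5 / 4 * q + 5 * c + b -> c <= 1 / 60 * x -> b <= 1 / 60 * sB ->
    0 <= q -> 0 <= M -> 0 <= x -> x <= 4 * M + 2 * q + sB / 2 by move: sB0; clear; lra.
  exact: (combine _ _ _ _ _ _ _ hv hn hd rv rB kb nb v0).
pose p := (1 - alpha) * gamma.
have p0 : 0 < p by rewrite mulr_gt0 ?subr_gt0// gE divr_gt0// mulr_gt0.
have pL : p * L = (1 - alpha) * (r / K) by rewrite /p gE; field; rewrite !gt_eqF.
have rK : r / K <= 1 / 2.
  rewrite -(ler_pXn2r (n := 2)) ?nnegrE ?divr_ge0//.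
  rewrite exprMn rr exprVn.
  have -> : m * K / K ^+ 2 = m / K by field; rewrite gt_eqF.
  have m60 : m * alpha ^+ 2 <= 1 / 60 * K * alpha ^+ 2.
    move: hK; rewrite ler_pdivrMr ?exprn_gt0// => hK.
    have t0' : 0 <= t by exact: le_trans t1.
    have at2 : alpha ^+ 2 <= t ^+ 2 by rewrite ler_pXn2r ?nnegrE//; lra.
    by have := ler_wpM2l m0' at2; lra.
  by move: m60; rewrite ler_pM2r ?exprn_gt0// ler_pdivrMr//; lra.
have pL2 : p * L <= 1 / 2.
  rewrite pL; apply: le_trans rK; rewrite ler_piMl ?divr_ge0//; lra.
(* Since [p * L <= 1 / 2], the smoothness term uses at most half of the negative [sB]. The other
   half cancels the [sB / 2] in the bound on [v]. *)
have {h1} h1 : sA <= 2 * (f0 - finf) / p + v - sB / 2 + p * L * (K * (s2 / m)).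
  have h : sA + sB - v <= 2 * (f0 - finf) / p + p * L * (sB + K * (s2 / m)).
    rewrite -(ler_pM2l (_ : 0 < p / 2)) ?divr_gt0//; apply: le_trans h1 _.
    by rewrite le_eqVlt; apply/orP; left; apply/eqP; rewrite -/p; field; rewrite !gt_eqF.
  have := ler_wpM2r sB0 pL2; move: h; rewrite mulrDr; lra.
have {h1} h1 : sA <= 2 * (f0 - finf) / p + 4 * (m * s2 * n0) +
   2 * (rho * (K * k2)) + (1 - alpha) * (r / K) * (K * (s2 / m)).
  by rewrite -pL; lra.
have -> : K^-1 * sA = sA / K by rewrite mulrC.
rewrite ler_pdivrMr//; apply: le_trans h1 _.
have e1 : 2 * (f0 - finf) / p = 2 * L * (f0 - finf) / ((1 - alpha) * r) * K.
  by rewrite /p gE; field; rewrite !gt_eqF// subr_gt0.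
have e2 : (1 - alpha) * (r / K) * (K * (s2 / m)) = (1 - alpha) * s2 / r * K.
  have -> : K = r ^+ 2 / m by rewrite rr; field; rewrite gt_eqF.
  by field; rewrite !gt_eqF.
have e3 : 2 * (rho * (K * k2)) = 2 * m * t ^+ 2 * k2 / (alpha ^+ 2 * K) * K.
  by rewrite /rho; field; rewrite !gt_eqF.
have e4 : 2 * m * s2 / K * (2 / ((2 - alpha) * alpha) * t - 1) * K =
   4 * (m * s2 * n0) + 2 * (m * s2).
  by rewrite /n0; field; rewrite !gt_eqF//; lra.
rewrite e1 e2 e3 ![(_ + _) * K]mulrDl e4.
have ff' : 0 <= f0 - finf by rewrite subr_ge0.
(* The slack in the target: its first two terms are twice what was obtained, and by [e4] its third
   exceeds the noise part of [v] by [2 * (m * s2)]. *)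
have d0 : 0 <= L * (f0 - finf) / ((1 - alpha) * r) * K.
  by rewrite mulr_ge0// divr_ge0// mulr_ge0.
have d1 : 0 <= (1 - alpha) * s2 / r * K.
  by rewrite mulr_ge0// divr_ge0// mulr_ge0.
have d2 : 0 <= m * s2 by rewrite mulr_ge0.
rewrite -!mulrA in d0 d1 *; lra.
Qed.

(** * Moments of the gradient noise of a fresh batch *)

Section FreshNoise.
Context {R : realType} {d : nat} {dO dX : measure_display} {O : measurableType dO}
  {Xi : measurableType dX} {I : eqType} (P : probability O R) (X : I -> O -> Xi).
Hypotheses (mX : forall i, measurable_fun setT (X i))
  (indepX : mutually_independent P X).
Variables (q : I) (D : probability Xi R).
Hypothesis lawX : forall A, measurable A -> P (X q @^-1` A) = D A.
Variables (G : 'rV[R]_d -> Xi -> 'rV[R]_d) (Gbar : 'rV[R]_d -> 'rV[R]_d) (sigma : R).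
Hypothesis mG : forall j : 'I_d, measurable_fun setT
  (fun p : d.-tuple R * Xi => G (vec_of_tuple p.1) p.2 0 j).
Hypothesis mGbar : forall j : 'I_d,
  measurable_fun setT ((fun x => Gbar x 0 j) \o vec_of_tuple).
Hypothesis unbiased : forall x (j : 'I_d),
  D.-integrable setT (fun s => (G x s 0 j)%:E) /\
  (\int[D]_s (G x s 0 j)%:E = (Gbar x 0 j)%:E)%E.
Hypothesis variance_le : forall x,
  (\int[D]_s (enorm (G x s - Gbar x) ^+ 2)%:E <= (sigma ^+ 2)%:E)%E.

Local Notation O' := (g_sigma_algebraType (cylinders_off X q)).

Variable V : O -> 'rV[R]_d.
Hypotheses (mV : mvec V) (mV' : mvec (V : O' -> _)).

Let noise w := G (V w) (X q w) - Gbar (V w).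

Let mcenter (j : 'I_d) : measurable_fun setT (fun p : d.-tuple R * Xi =>
  (G (vec_of_tuple p.1) p.2 - Gbar (vec_of_tuple p.1)) 0 j).
Proof.
under eq_fun do rewrite !mxE.
apply: measurable_funB; first exact: mG.
exact: (measurableT_comp (mGbar j)).
Qed.

Let noiseE w : noise w =
  G (vec_of_tuple (tuple_of_vec (V w))) (X q w) -
  Gbar (vec_of_tuple (tuple_of_vec (V w))).
Proof. by rewrite tuple_of_vecK. Qed.

Let mvec_noise : mvec noise.
Proof.
move=> j; under eq_fun do rewrite noiseE.
apply: (measurableT_comp (mcenter j)
  (g := fun w => (tuple_of_vec (V w), X q w))).
by apply: measurable_fun_pair => //; exact: measurable_tuple_of_vec.
Qed.

(** Freezing [V], which does not see batch [q], reduces the claim to the variance bound at a fixed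
    point. Nonnegativity lets this precede any integrability of the noise, which is then deduced
    from it. *)
Let tonelli_noise : (\int[P]_w (sqn (noise w))%:E <= (sigma ^+ 2)%:E)%E.
Proof.
pose f (p : d.-tuple R * Xi) :=
  (sqn (G (vec_of_tuple p.1) p.2 - Gbar (vec_of_tuple p.1)))%:E.
have mf : measurable_fun setT f.
  by apply/measurable_EFinP; apply: measurable_sum => j; exact: measurable_funM.
have f0 p : (0 <= f p)%E by rewrite lee_fin sqn_ge0.
have mH := measurable_tuple_of_vec mV'.
under eq_integral do rewrite noiseE.
rewrite (fresh_tonelli mX indepX lawX mH mf f0).
apply: (@le_trans _ _ (\int[P]_w (sigma ^+ 2)%:E)%E); last first.
  by rewrite integral_cst// [X in (_ * X)%E]probability_setT mule1.
apply: ge0_le_integral => //.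
- by move=> w _; apply: integral_ge0.
- apply: (measurableT_comp (f := fubini_F D f)).
    exact: measurable_fun_fubini_tonelli_F.
  exact: measurable_tuple_of_vec.
- move=> w _; rewrite /f /=; under eq_integral do rewrite -enorm_sqr.
  exact: variance_le.
Qed.

Lemma L2v_fresh_noise : L2v P noise.
Proof.
apply: (L2v_le mvec_noise (fun=> lexx _)); apply/integrableP; split.
  apply/measurable_EFinP; apply: measurable_sum => j.
  exact: measurable_funM.
apply: le_lt_trans (ltry (sigma ^+ 2)); apply: le_trans tonelli_noise.
by under eq_integral do rewrite /= ger0_norm ?sqn_ge0//.
Qed.

Lemma fresh_noise_variance : \int[P]_w sqn (noise w) <= sigma ^+ 2.
Proof.
rewrite -lee_fin; apply: le_trans tonelli_noise.
by rewrite fineK//; exact: (integrable_fin_num measurableT (L2v_sqn L2v_fresh_noise)).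
Qed.

(** Coordinate by coordinate, [V] and [U] are frozen together and the batch is integrated first;
    unbiasedness makes the inner integral vanish. *)
Lemma fresh_noise_orthogonal (U : O -> 'rV[R]_d) : L2v P U -> mvec (U : O' -> _) ->
  \int[P]_w dot (U w) (noise w) = 0.
Proof.
move=> LU mU'; rewrite ex_sum; last first.
  by move=> j; apply: L2M; [exact: LU|exact: L2v_fresh_noise].
rewrite big1// => j _.
pose f (p : (d.-tuple R * R) * Xi) :=
  (p.1.2 * (G (vec_of_tuple p.1.1) p.2 - Gbar (vec_of_tuple p.1.1)) 0 j)%:E.
have mf : measurable_fun setT f.
  apply/measurable_EFinP; apply: measurable_funM.
    exact: measurableT_comp.
  apply: (measurableT_comp (mcenter j)
    (g := fun p : (d.-tuple R * R) * Xi => (p.1.1, p.2))).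
  by apply: measurable_fun_pair => //; exact: measurableT_comp.
have mH : measurable_fun setT ((fun w => (tuple_of_vec (V w), U w 0 j)) : O' -> _).
  by apply: measurable_fun_pair => //; exact: (measurable_tuple_of_vec mV').
have fE w : f ((tuple_of_vec (V w), U w 0 j), X q w) = (U w 0 j * noise w 0 j)%:E.
  by rewrite /f /= tuple_of_vecK.
rewrite /Rintegral; under eq_integral do rewrite -fE.
rewrite (fresh_fubini mX indepX lawX mH mf); last first.
  under eq_fun do rewrite fE.
  by apply: L2M; [exact: LU|exact: L2v_fresh_noise].
rewrite integral0_eq// => w _; rewrite /f /= tuple_of_vecK.
have [intG GE] := unbiased (V w) j.
under eq_integral do rewrite !mxE EFinM EFinB.
rewrite integralZl//; last first.
  by apply: integrableB => //; exact: finite_measure_integrable_cst.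
rewrite integralB//; last exact: finite_measure_integrable_cst.
rewrite GE integral_cst//= [X in (_ - _ * X)%E](probability_setT D).
by rewrite mule1 subee// mule0.
Qed.

End FreshNoise.

(** * The convergence bound *)

Lemma lipschitz_coord_continuous {R : realType} {d : nat} (f : 'rV[R]_d -> R) (C : R) :
  0 < C -> (forall x y, (f x - f y) ^+ 2 <= C ^+ 2 * sqn (x - y)) -> continuous f.
Proof.
move=> C0 lipf x A /nbhs_ballP[e /= e0 eA].
have D0 : (0 : R) < d.+1%:R by rewrite ltr0n.
(* Balls are for the maximum norm, so the squared Euclidean distance is at most [d%:R * del ^+ 2].
   Using [d.+1] avoids a root, covers [d = 0] and keeps the final inequality strict. *)
pose del := e / (C * d.+1%:R); have del0 : 0 < del by rewrite divr_gt0// mulr_gt0.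
apply/nbhs_ballP; exists del => //= y [_ bxy]; apply: eA; rewrite /= /ball /=.
have xy j : (x 0 j - y 0 j) ^+ 2 <= del ^+ 2.
  have h := bxy 0 j.
  rewrite -[leLHS]real_normK ?num_real// ler_pXn2r ?nnegrE ?normr_ge0 ?(ltW del0)//.
  exact/ltW.
rewrite -(ltr_pXn2r (n := 2)) ?nnegrE ?normr_ge0 ?(ltW e0)// real_normK ?num_real//.
apply: (le_lt_trans (lipf _ _)).
apply: (@le_lt_trans _ _ (C ^+ 2 * (d%:R * del ^+ 2))).
  rewrite ler_wpM2l ?sqr_ge0// /sqn /dot.
  apply: (@le_trans _ _ (\sum_(j < d) del ^+ 2)).
    by apply: ler_sum => j _; rewrite !mxE -expr2.
  by rewrite sumr_const card_ord mulr_natl.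
have -> : C ^+ 2 * (d%:R * del ^+ 2) = e ^+ 2 * (d%:R / d.+1%:R ^+ 2).
  by rewrite /del; field; rewrite !gt_eqF.
rewrite gtr_pMr ?exprn_gt0// ltr_pdivrMr ?exprn_gt0// mul1r.
by rewrite -natrX ltr_nat -mulnn leq_pmulr.
Qed.

Section ProcessMeasurable.
Context {R : realType} {d m : nat} {dX : measure_display} {Xi : measurableType dX}
  {dO : measure_display} {O : measurableType dO}.
Variables (g : 'I_m -> 'rV[R]_d -> Xi -> 'rV[R]_d) (gamma alpha : R) (tau : nat)
  (x0 : 'rV[R]_d) (xi : nat -> 'I_m -> O -> Xi).
Hypothesis mg : forall i (j : 'I_d), measurable_fun setT
  (fun p : d.-tuple R * Xi => g i (vec_of_tuple p.1) p.2 0 j).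

Lemma mvec_oracle i (V : O -> 'rV[R]_d) (s : O -> Xi) :
  mvec V -> measurable_fun setT s -> mvec (fun w => g i (V w) (s w)).
Proof.
move=> mV ms j.
rewrite [X in measurable_fun _ X](_ : _ =
  (fun p : d.-tuple R * Xi => g i (vec_of_tuple p.1) p.2 0 j) \o
  (fun w => ((tuple_of_vec \o V) w, s w))); last first.
  by apply/funext => w; rewrite /= tuple_of_vecK.
by apply: (measurableT_comp (mg i j)); apply: measurable_fun_pair => //;
  exact: measurable_tuple_of_vec.
Qed.

(** [O] is any measurable space, so the lemma serves for the full sigma-algebra and for the one that
    omits a batch. For the latter it matters that only batches before [k] are assumed measurable. *)
Lemma mvec_local_model k :
  (forall s j, (s < k)%N -> measurable_fun setT (xi s j)) ->
  (forall i, mvec (fun w => local_model g gamma alpha tau x0 (fun k i => xi k i w) k i)) /\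
  mvec (fun w => anchor g gamma alpha tau x0 (fun k i => xi k i w) k).
Proof.
elim: k => [|k IH] mxi; first by split => [i|]; exact: mvec_cst.
have [mx mz] := IH (fun s j lt => mxi s j (leqW lt)).
have mx' i :
    mvec (fun w => local_model g gamma alpha tau x0 (fun k i => xi k i w) k.+1 i).
  under eq_fun do rewrite local_modelS /=.
  have mh : mvec (fun w => local_model g gamma alpha tau x0 (fun k i => xi k i w) k i -
      gamma *: stoch_grad g gamma alpha tau x0 (fun k i => xi k i w) k i).
    by apply: mvecB => //; apply: mvecZ; apply: mvec_oracle => //; exact: mxi.
  by case: (_ == _) => //; apply: mvecB => //; apply: mvecZ; exact: mvecB.
split => //; under eq_fun do rewrite anchorS.
by case: (_ == _) => //; exact: mvec_mean.
Qed.

End ProcessMeasurable.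

(** * Second moments along the trajectory and descent in expectation *)

Section Convergence.
Context {R : realType} {d m : nat} {dO dX : measure_display}
  {O : measurableType dO} {Xi : measurableType dX}.
Variables (P : probability O R) (D : 'I_m -> probability Xi R)
  (F : 'I_m -> 'rV[R]_d -> R) (g : 'I_m -> 'rV[R]_d -> Xi -> 'rV[R]_d)
  (L sigma kappa : R) (tau : nat) (alpha gamma : R) (x0 : 'rV[R]_d)
  (xi : nat -> 'I_m -> O -> Xi).
Hypotheses (m_gt0 : (0 < m)%N) (L_gt0 : 0 < L) (tau_gt0 : (0 < tau)%N)
  (alpha01 : 0 < alpha < 1) (gamma_gt0 : 0 < gamma).
Hypothesis diffF : forall i x, differentiable (F i) x.
Hypothesis smoothF : forall i x y,
  sqn (grad (F i) x - grad (F i) y) <= L ^+ 2 * sqn (x - y).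
Hypothesis mg : forall i (j : 'I_d), measurable_fun setT
  (fun p : d.-tuple R * Xi => g i (vec_of_tuple p.1) p.2 0 j).
Hypothesis unbiased : forall i x (j : 'I_d),
  (D i).-integrable setT (fun s => (g i x s 0 j)%:E) /\
  (\int[D i]_s (g i x s 0 j)%:E = (grad (F i) x 0 j)%:E)%E.
Hypothesis variance_le : forall i x,
  (\int[D i]_s (enorm (g i x s - grad (F i) x) ^+ 2)%:E <= (sigma ^+ 2)%:E)%E.
Hypothesis dissimilarity : forall x,
  msq (fun i => grad (F i) x - mean (fun i => grad (F i) x)) <= kappa ^+ 2.
Hypothesis mxi : forall k i, measurable_fun setT (xi k i).
Hypothesis lawxi : forall k i A, measurable A -> P (xi k i @^-1` A) = D i A.
Hypothesis indepxi : mutually_independent P (fun p : nat * 'I_m => xi p.1 p.2).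

Let batch (p : nat * 'I_m) := xi p.1 p.2.
(** The sample space with the sigma-algebra of all batches except that of worker [i] at step [k];
    measurability on it stands for independence from that batch. *)
Let off k i := g_sigma_algebraType (cylinders_off batch (k, i)).

Let x k i w := local_model g gamma alpha tau x0 (fun k i => xi k i w) k i.
Let z k w := anchor g gamma alpha tau x0 (fun k i => xi k i w) k.
Let G k i w := stoch_grad g gamma alpha tau x0 (fun k i => xi k i w) k i.
Let y k w := olsgd_y g gamma alpha tau x0 (fun k i => xi k i w) k.
Let H k i w := grad (F i) (x k i w).
Let N k i w := G k i w - H k i w.
Let gradF v := mean (fun i => grad (F i) v).
Let Fbar v := m%:R^-1 * \sum_(i < m) F i v.

Let mgrad i (j : 'I_d) :
  measurable_fun setT ((fun v => grad (F i) v 0 j) \o vec_of_tuple).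
Proof.
apply: continuous_measurable_tuple; apply: (lipschitz_coord_continuous L_gt0) => u v.
exact: le_trans (coordB_le_sqn _ _ j) (smoothF i u v).
Qed.

Let mvec_grad dT (T : measurableType dT) i (V : T -> 'rV[R]_d) :
  mvec V -> mvec (fun w => grad (F i) (V w)).
Proof. by move=> mV j; apply: (mvec_comp (mgrad i j)). Qed.

Let mbatch p : measurable_fun setT (batch p).
Proof. exact: mxi. Qed.

Let measurable_off k i s j : (s, j) != (k, i) ->
  measurable_fun setT (xi s j : off k i -> Xi).
Proof.
move=> ne _ A mA; rewrite setTI; apply: sub_sigma_algebra.
exact: (cylinders_offE batch ne mA).
Qed.

Let mx k i : mvec (x k i).
Proof.
have [h _] := @mvec_local_model R d m _ _ _ O g gamma alpha tau x0 xi mg k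
  (fun s j _ => mxi s j).
exact: h.
Qed.

Let mx_off k i s j : (s <= k)%N -> mvec (x s j : off k i -> _).
Proof.
move=> sk; have past s' j' : (s' < s)%N ->
    measurable_fun setT (xi s' j' : off k i -> Xi).
  move=> lt; apply: measurable_off; apply/eqP => -[e _].
  by rewrite e ltnNge sk in lt.
have [h _] := @mvec_local_model R d m _ _ _ (off k i) g gamma alpha tau x0 xi mg s past.
exact: h.
Qed.

Let L2v_N k i : L2v P (N k i).
Proof.
exact: (@L2v_fresh_noise _ _ _ _ _ _ _ P batch mbatch indepxi (k, i) (D i) (lawxi k i)
  (g i) (grad (F i)) sigma (mg i) (mgrad i) (variance_le i) (x k i) (mx k i)
  (@mx_off k i k i (leqnn k))).
Qed.

Let N_variance k i : \int[P]_w sqn (N k i w) <= sigma ^+ 2.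
Proof.
exact: (@fresh_noise_variance _ _ _ _ _ _ _ P batch mbatch indepxi (k, i) (D i) (lawxi k i)
  (g i) (grad (F i)) sigma (mg i) (mgrad i) (variance_le i) (x k i) (mx k i)
  (@mx_off k i k i (leqnn k))).
Qed.

Let N_orthogonal k i (U : O -> 'rV[R]_d) : L2v P U -> mvec (U : off k i -> _) ->
  \int[P]_w dot (U w) (N k i w) = 0.
Proof.
exact: (@fresh_noise_orthogonal _ _ _ _ _ _ _ P batch mbatch indepxi (k, i) (D i) (lawxi k i)
  (g i) (grad (F i)) sigma (mg i) (mgrad i) (unbiased i) (variance_le i) (x k i) (mx k i)
  (@mx_off k i k i (leqnn k))).
Qed.

Let mN_off k i s j : (s <= k)%N -> (s, j) != (k, i) -> mvec (N s j : off k i -> _).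
Proof.
move=> sk ne; apply: mvecB.
  by apply: mvec_oracle => //; [exact: mx_off|exact: measurable_off].
by apply: mvec_grad; exact: mx_off.
Qed.

(** A Lipschitz gradient grows at most linearly, so it preserves square integrability. *)
Let L2v_grad i (V : O -> 'rV[R]_d) : L2v P V -> L2v P (fun w => grad (F i) (V w)).
Proof.
move=> LV; apply: (@L2v_le _ _ _ P _ _
  (fun w => 2 * sqn (grad (F i) 0) + 2 * (L ^+ 2 * sqn (V w)))).
- exact/mvec_grad/L2v_mvec.
- move=> w; apply: le_trans (sqn_le_double (grad (F i) 0) _) _.
  by have := smoothF i (V w) 0; rewrite subr0 lerD2l ler_pM2l.
- by apply: L1D; [exact: L1_cst|exact/L1Z/L1Z/L2v_sqn].
Qed.

Let L2v_xz k : (forall i, L2v P (x k i)) /\ L2v P (z k).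
Proof.
elim: k => [|k [Lx Lz]]; first by split => [i|]; exact: L2v_cst.
have Lx' i : L2v P (x k.+1 i).
  have Lh : L2v P (fun w => x k i w - gamma *: G k i w).
    apply: L2vB => //; apply: L2vZ.
    have -> : G k i = fun w => N k i w + H k i w.
      by apply/funext => w; rewrite /N subrK.
    by apply: L2vD; [exact: L2v_N|exact: L2v_grad].
  rewrite (_ : x k.+1 i = fun w =>
    if (k.+1 %% tau == 0)%N then
      x k i w - gamma *: G k i w - alpha *: (x k i w - gamma *: G k i w - z k w)
    else x k i w - gamma *: G k i w); last first.
    by apply/funext => w; rewrite /x local_modelS.
  by case: (_ == _) => //; apply: L2vB => //; apply: L2vZ; exact: L2vB.
split => //.
rewrite (_ : z k.+1 = fun w =>
    if (k.+1 %% tau == 0)%N then mean (x k.+1 ^~ w) else z k w); last first.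
  by apply/funext => w; rewrite /z anchorS.
by case: (_ == _) => //; exact: L2v_mean.
Qed.

Let L2v_x k i : L2v P (x k i). Proof. by have [] := L2v_xz k. Qed.

Let L2v_H k i : L2v P (H k i). Proof. exact: L2v_grad. Qed.

Let yE k : y k = fun w => (1 - alpha) *: mean (x k ^~ w) + alpha *: z k w.
Proof. by apply/funext => w; rewrite /y olsgd_yE. Qed.

Let L2v_y k : L2v P (y k).
Proof.
rewrite yE; apply: L2vD; last by apply: L2vZ; have [] := L2v_xz k.
by apply: L2vZ; exact: L2v_mean.
Qed.

Let my_off k i : mvec (y k : off k i -> _).
Proof.
rewrite yE; apply: mvecD; apply: mvecZ.
  by apply: mvec_mean => j; exact: mx_off.
have past s j : (s < k)%N -> measurable_fun setT (xi s j : off k i -> Xi).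
  move=> lt; apply: measurable_off; apply/eqP => -[e _].
  by rewrite e ltnn in lt.
have [_ h] := @mvec_local_model R d m _ _ _ (off k i) g gamma alpha tau x0 xi mg k past.
exact: h.
Qed.

Let mean_N_orthogonal k (U : O -> 'rV[R]_d) : L2v P U ->
  (forall i, mvec (U : off k i -> _)) -> \int[P]_w dot (U w) (mean (N k ^~ w)) = 0.
Proof.
move=> LU mU.
have LUN i : L1 P (fun w => dot (U w) (N k i w)) by exact: L2v_dot.
under eq_Rintegral do rewrite dotZr dot_sumr.
rewrite exZ ?ex_sum//; last exact: L1_sum.
by rewrite big1 ?mulr0// => i _; exact: N_orthogonal.
Qed.

(* The cross terms vanish because the batches of distinct workers are independent. *)
Let mean_N_variance k : \int[P]_w sqn (mean (N k ^~ w)) <= sigma ^+ 2 / m%:R.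
Proof.
have LNN i j : L1 P (fun w => dot (N k j w) (N k i w)) by exact: L2v_dot.
have cross i j : \int[P]_w dot (N k j w) (N k i w) <=
    if j == i then sigma ^+ 2 else 0.
  case: eqP => [->|/eqP ji]; first exact: N_variance.
  rewrite N_orthogonal//; apply: mN_off => //.
  by rewrite xpair_eqE eqxx.
under eq_Rintegral do rewrite sqnZ /sqn dot_sumr.
have LN i : L1 P (fun w => dot (\sum_(j < m) N k j w) (N k i w)).
  by under eq_fun do rewrite dotC dot_sumr; apply: L1_sum => j;
    under eq_fun do rewrite dotC; exact: LNN.
rewrite exZ ?ex_sum//; last exact: L1_sum.
have m0 : (0 : R) < m%:R by rewrite ltr0n.
have -> : sigma ^+ 2 / m%:R = m%:R^-1 ^+ 2 * \sum_(i < m) sigma ^+ 2.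
  by rewrite sumr_const card_ord -mulr_natl; field; rewrite gt_eqF.
rewrite ler_wpM2l ?sqr_ge0//; apply: ler_sum => i _.
under eq_Rintegral do rewrite dotC dot_sumr.
rewrite ex_sum; last by move=> j; under eq_fun do rewrite dotC; exact: LNN.
apply: (@le_trans _ _ (\sum_(j < m) if j == i then sigma ^+ 2 else 0)).
  by apply: ler_sum => j _; under eq_Rintegral do rewrite dotC; exact: cross.
by rewrite -big_mkcond big_pred1_eq.
Qed.

(** The family [A] is a parameter so that the noise [N] and the true gradients [H] can drive the
    recursion separately. *)
Let centre (A : nat -> 'I_m -> O -> 'rV[R]_d) k i w :=
  - gamma *: (A k i w - (1 - alpha) *: mean (A k ^~ w)).
Let dev (A : nat -> 'I_m -> O -> 'rV[R]_d) k i w :=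
  deviation alpha tau (fun k i => centre A k i w) k i.

Let x_sub_y k i w : x k i w - y k w = dev N k i w + dev H k i w.
Proof.
rewrite /x /y local_deviation// /dev -deviationD//.
congr deviation; apply/funext => k'; apply/funext => i'.
rewrite /centre -scalerDr; congr (_ *: _).
have GE j : G k' j w = N k' j w + H k' j w by rewrite subrK.
rewrite -[stoch_grad _ _ _ _ _ _ _ _]/(G k' i' w) GE.
rewrite -[stoch_grad _ _ _ _ _ _ _]/(G k' ^~ w).
rewrite (_ : G k' ^~ w = fun j => N k' j w + H k' j w); last exact/funext.
by rewrite meanD scalerDr opprD addrACA.
Qed.

Let L2v_centre A k i : (forall k i, L2v P (A k i)) -> L2v P (centre A k i).
Proof. by move=> LA; apply: L2vZ; apply: L2vB => //; apply: L2vZ; exact: L2v_mean. Qed.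

Let L2v_dev A k i : (forall k i, L2v P (A k i)) -> L2v P (dev A k i).
Proof. by move=> LA; apply: L2v_deviation => k' i'; exact: L2v_centre. Qed.

Let msq_centre A k w : msq (centre A k ^~ w) =
  gamma ^+ 2 * (msq (A k ^~ w) - (1 - alpha ^+ 2) * sqn (mean (A k ^~ w))).
Proof. by rewrite /centre msqZ msq_shift// sqrrN; congr (_ * (_ - _ * _)); ring. Qed.

Let L1_msq_dev A k : (forall k i, L2v P (A k i)) -> L1 P (fun w => msq (dev A k ^~ w)).
Proof. by move=> LA; apply: L2v_msq => i; exact: L2v_dev. Qed.

Let mdev_off k i j : mvec (dev N k j : off k i -> _).
Proof.
apply: mvec_deviation => k' j' lt; apply: mvecZ; apply: mvecB.
  by apply: mN_off; [exact: ltnW|apply/eqP => -[e _]; rewrite e ltnn in lt].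
apply: mvecZ; apply: mvec_mean => j''.
by apply: mN_off; [exact: ltnW|apply/eqP => -[e _]; rewrite e ltnn in lt].
Qed.

Let dev_N_orthogonal k i : \int[P]_w dot (dev N k i w) (centre N k i w) = 0.
Proof.
have Ld := L2v_dev k i L2v_N.
have LdN : L1 P (fun w => dot (dev N k i w) (N k i w)) by exact: L2v_dot.
have LdM : L1 P (fun w => dot (dev N k i w) (mean (N k ^~ w))).
  by apply: L2v_dot => //; exact: L2v_mean.
transitivity (\int[P]_w (- gamma * (dot (dev N k i w) (N k i w) +
    - (1 - alpha) * dot (dev N k i w) (mean (N k ^~ w))))).
  by apply: eq_Rintegral => w _; rewrite /centre -scaleNr dotZr dotDr dotZr.
rewrite exZ; last by apply: L1D => //; exact: L1Z.
rewrite exD//; last exact: L1Z.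
rewrite exZ// N_orthogonal// mean_N_orthogonal//.
by rewrite mulr0 addr0 mulr0.
Qed.

Let centre_N_variance k :
  \int[P]_w msq (centre N k ^~ w) <= gamma ^+ 2 * sigma ^+ 2.
Proof.
have LmN : L1 P (fun w => msq (N k ^~ w)) by exact: L2v_msq.
apply: (@le_trans _ _ (\int[P]_w (gamma ^+ 2 * msq (N k ^~ w)))).
  apply: ex_le => [||w]; [|exact: L1Z|].
    by apply: L2v_msq => i; exact: L2v_centre.
  rewrite msq_centre ler_wpM2l ?sqr_ge0// lerBlDr lerDl mulr_ge0 ?sqn_ge0//.
  by rewrite subr_ge0 expr_le1// ltW//; case/andP: alpha01.
rewrite exZ// ler_wpM2l ?sqr_ge0//.
have LsN i : L1 P (fun w => sqn (N k i w)) by exact: L2v_sqn.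
rewrite exZ ?ex_sum//; last exact: L1_sum.
have m0 : (0 : R) < m%:R by rewrite ltr0n.
rewrite ler_pdivrMl//; apply: (@le_trans _ _ (\sum_(i < m) sigma ^+ 2)).
  by apply: ler_sum => i _; exact: N_variance.
by rewrite sumr_const card_ord mulr_natl.
Qed.

(** The new noise is orthogonal to the accumulated one, so second moments add and a synchronisation
    multiplies them by [(1 - alpha) ^+ 2]. The bracket is the periodic solution of that recursion,
    with [(2 - alpha) * alpha = 1 - (1 - alpha) ^+ 2]. *)
Let dev_N_variance k : \int[P]_w msq (dev N k ^~ w) <= gamma ^+ 2 * sigma ^+ 2 *
  (tau%:R * (1 - alpha) ^+ 2 / ((2 - alpha) * alpha) + (k %% tau)%:R).
Proof.
have [a0 a1] := andP alpha01.
have aa : 0 < (2 - alpha) * alpha.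
  by rewrite mulr_gt0// subr_gt0 (lt_trans a1)// ltr1n.
set B := _ / _; have B0 : 0 <= B.
  by rewrite divr_ge0 ?(ltW aa)// mulr_ge0// sqr_ge0.
elim: k => [|k IH].
  apply: (@le_trans _ _ (\int[P]_w 0)); last first.
    rewrite ex_cst; apply: mulr_ge0; last exact: addr_ge0.
    exact: mulr_ge0 (sqr_ge0 _) (sqr_ge0 _).
  apply: ex_le => [||w]; [exact: L1_msq_dev|exact: L1_cst|].
  by rewrite /msq big1 ?mulr0// => i _; exact: dot0l.
set b := (k.+1 %% tau == 0)%N; pose c : R := if b then 1 - alpha else 1.
have Lcross i : L1 P (fun w => dot (dev N k i w) (centre N k i w)).
  by apply: L2v_dot; [exact: L2v_dev|exact: L2v_centre].
have Lc : L1 P (fun w => msq (centre N k ^~ w)).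
  by apply: L2v_msq => i; exact: L2v_centre.
have Lsum : L1 P (fun w => msq (fun i => dev N k i w + centre N k i w)).
  by apply: L2v_msq => i; apply: L2vD; [exact: L2v_dev|exact: L2v_centre].
apply: (@le_trans _ _
    (\int[P]_w (c ^+ 2 * msq (fun i => dev N k i w + centre N k i w)))).
  by apply: ex_le => [||w]; [exact: L1_msq_dev|exact: L1Z|exact: msq_pull].
rewrite exZ//.
have step : \int[P]_w msq (fun i => dev N k i w + centre N k i w) <=
    gamma ^+ 2 * sigma ^+ 2 * (B + (k %% tau)%:R + 1).
  under eq_Rintegral do rewrite msqD.
  have Lx : L1 P (fun w =>
      m%:R^-1 * \sum_(i < m) dot (dev N k i w) (centre N k i w)).
    by apply: L1Z; exact: L1_sum.
  rewrite exD//; last by apply: L1D; [exact: L1_msq_dev|exact: L1Z].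
  rewrite exD; [|exact: L1_msq_dev|exact: L1Z].
  rewrite [X in _ + X + _]exZ// [X in _ + 2 * X + _]exZ; last exact: L1_sum.
  rewrite ex_sum//.
  rewrite big1 ?mulr0 ?addr0; last by move=> i _; exact: dev_N_orthogonal.
  by rewrite mulrDr mulr1; apply: lerD.
apply: le_trans (ler_wpM2l (sqr_ge0 c) step) _.
rewrite mulrCA; apply: ler_wpM2l; first exact: mulr_ge0 (sqr_ge0 _) (sqr_ge0 _).
have a_neq0 : alpha != 0 by rewrite gt_eqF.
have a2_neq0 : 2 - alpha != 0 by rewrite gt_eqF// subr_gt0 (lt_trans a1)// ltr1n.
rewrite /c /b /B le_eqVlt; apply/orP; left; apply/eqP.
have [[-> [-> ->]]|[-> ->]] := @modnS_cases R tau tau_gt0 k.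
  by field; rewrite a_neq0 a2_neq0.
by rewrite expr1n mul1r addrA.
Qed.

Let disagreement k w := msq (fun i => x k i w - y k w).

(** A pathwise bound: the gain of the recursion times its input, where smoothness replaces gradients
    at the local models by gradients at [y] and so brings the disagreement back in. *)
Let drift_gain K w : \sum_(k < K) msq (dev H k ^~ w) <=
  gamma ^+ 2 * (tau%:R / alpha) ^+ 2 * \sum_(k < K)
    (5 / 4 * kappa ^+ 2 + 5 * L ^+ 2 * disagreement k w +
     alpha ^+ 2 * sqn (mean (H k ^~ w))).
Proof.
apply: le_trans (deviation_gain m_gt0 tau_gt0 alpha01 (fun k i => centre H k i w) K) _.
rewrite -[leRHS]mulrA [leRHS]mulrCA; apply: ler_wpM2l; first exact: sqr_ge0.
rewrite mulr_sumr; apply: ler_sum => k _.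
rewrite (msq_centre H); apply: ler_wpM2l; first exact: sqr_ge0.
have xy : msq (fun i => H k i w - grad (F i) (y k w)) <= L ^+ 2 * disagreement k w.
  by apply: msq_le_scale => i; exact: smoothF.
rewrite -[5 * L ^+ 2 * _]mulrA.
exact: (msq_shrunk_le m_gt0 alpha (dissimilarity (y k w)) xy).
Qed.

Let p := (1 - alpha) * gamma.

Let p_ge0 : 0 <= p.
Proof. by rewrite mulr_ge0 ?(ltW gamma_gt0)// subr_ge0 ltW//; case/andP: alpha01. Qed.

Let FbarE : Fbar = m%:R^-1 \*: (\sum_(i < m) F i).
Proof. by apply/funext => v; rewrite /Fbar fct_sumE. Qed.

Let diff_Fbar v : differentiable Fbar v.
Proof. by rewrite FbarE; exact/differentiableZ/differentiable_sum. Qed.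

Let grad_Fbar v : grad Fbar v = gradF v.
Proof. exact: grad_mean. Qed.

Let smooth_Fbar u v : sqn (grad Fbar u - grad Fbar v) <= L ^+ 2 * sqn (u - v).
Proof.
rewrite !grad_Fbar /gradF -scaleN1r -meanZ -meanD.
apply: le_trans (sqn_mean_le m_gt0 _) _.
rewrite -(msq_cst m_gt0 (u - v)); apply: msq_le_scale => i.
by rewrite scaleN1r; exact: smoothF.
Qed.

(** By Jensen and smoothness, the averaged local gradient differs from the gradient at [y] by at
    most the disagreement. The last bracket is linear in the noise and has mean zero. *)
Let descent k w : Fbar (y k.+1 w) <= Fbar (y k w)
    - p / 2 * (sqn (gradF (y k w)) + sqn (mean (H k ^~ w)) - L ^+ 2 * disagreement k w)
    + L / 2 * p ^+ 2 * (sqn (mean (H k ^~ w)) + sqn (mean (N k ^~ w)))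
    + (L * p ^+ 2 * dot (mean (H k ^~ w)) (mean (N k ^~ w)) -
       p * dot (gradF (y k w)) (mean (N k ^~ w))).
Proof.
apply: descent_split => //.
  have -> : y k.+1 w = y k w + - p *: (mean (N k ^~ w) + mean (H k ^~ w)).
    rewrite /y olsgd_yS// -meanD scaleNr; congr (_ - _ *: mean _).
    by apply/funext => i; rewrite subrK.
  by rewrite -grad_Fbar; apply: smooth_upper_bound.
rewrite -scaleN1r -meanZ -meanD; apply: le_trans (sqn_mean_le m_gt0 _) _.
by apply: msq_le_scale => i; rewrite scaleN1r; exact: smoothF.
Qed.

Let L2v_gradF k : L2v P (fun w => gradF (y k w)).
Proof. by apply: L2v_mean => i; exact: L2v_grad. Qed.

Lemma L1_sqn_gradient k : L1 P (fun w => sqn (gradF (y k w))).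
Proof. exact: L2v_sqn. Qed.

Let L2v_meanH k : L2v P (fun w => mean (H k ^~ w)).
Proof. exact: L2v_mean. Qed.

Let L2v_meanN k : L2v P (fun w => mean (N k ^~ w)).
Proof. exact: L2v_mean. Qed.

Let L1_disagreement k : L1 P (disagreement k).
Proof. by apply: (L2v_msq (V := fun i w => x k i w - y k w)) => i; exact: L2vB. Qed.

Variable finf : R.
Hypothesis finf_le : forall v, finf <= Fbar v.

(** The value lies between [finf] and the quadratic upper bound around 0, both integrable along
    [y]. *)
Let L1_Fbar k : L1 P (fun w => Fbar (y k w)).
Proof.
apply: (@L1_le _ _ _ P _ (fun w => `|finf| + `|Fbar 0 + dot (grad Fbar 0) (y k w) +
  L / 2 * sqn (y k w)|)).
- apply: mvec_comp; last exact/L2v_mvec/L2v_y.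
  apply: continuous_measurable_tuple => v; exact: differentiable_continuous.
- move=> w.
  have := smooth_upper_bound L_gt0 diff_Fbar smooth_Fbar 0 (y k w).
  rewrite add0r => up; have lo := finf_le (y k w).
  rewrite ler_norml lerNl; apply/andP; split.
    apply: (@le_trans _ _ `|finf|); last by rewrite lerDl.
    by rewrite -normrN; apply: le_trans (ler_norm _); rewrite lerN2.
  by apply: le_trans up _; rewrite (le_trans (ler_norm _))// lerDr.
- apply: L1D; first exact: L1_cst.
  apply: integrable_norm; apply: L1D; last by apply: L1Z; exact: L2v_sqn.
  by apply: L1D; [exact: L1_cst|apply: L2v_dot => //; exact: L2v_cst].
Qed.

Let f k := \int[P]_w Fbar (y k w).
Let a k := \int[P]_w sqn (gradF (y k w)).
Let b k := \int[P]_w sqn (mean (H k ^~ w)).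
Let v k := \int[P]_w disagreement k w.

(** Integrates [descent]: [y k] and the [H k j] are measurable without any single batch of step [k],
    so both terms linear in the noise vanish. *)
Let descent_ex k : p / 2 * (a k + b k - L ^+ 2 * v k) <=
  f k - f k.+1 + L / 2 * p ^+ 2 * (b k + sigma ^+ 2 / m%:R).
Proof.
have La : L1 P (fun w => sqn (gradF (y k w))) by exact: L2v_sqn.
have Lb : L1 P (fun w => sqn (mean (H k ^~ w))) by exact: L2v_sqn.
have Ln : L1 P (fun w => sqn (mean (N k ^~ w))) by exact: L2v_sqn.
have Lv : L1 P (fun w => disagreement k w) by exact: L1_disagreement.
have Lf : L1 P (fun w => Fbar (y k w)) by exact: L1_Fbar.
have LHN : L1 P (fun w => dot (mean (H k ^~ w)) (mean (N k ^~ w))).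
  exact: L2v_dot.
have LgN : L1 P (fun w => dot (gradF (y k w)) (mean (N k ^~ w))).
  exact: L2v_dot.
have HN0 : \int[P]_w dot (mean (H k ^~ w)) (mean (N k ^~ w)) = 0.
  apply: mean_N_orthogonal => // i; apply: mvec_mean => j.
  by apply: mvec_grad; exact: mx_off.
have gN0 : \int[P]_w dot (gradF (y k w)) (mean (N k ^~ w)) = 0.
  apply: mean_N_orthogonal => // i; apply: mvec_mean => j.
  by apply: mvec_grad; exact: my_off.
have Lab := L1D La Lb.
have LV := L1Z (L ^+ 2) Lv.
have Labv := L1B Lab LV.
have L1' := L1B Lf (L1Z (p / 2) Labv).
have L2' := L1Z (L / 2 * p ^+ 2) (L1D Lb Ln).
have L3' := L1B (L1Z (L * p ^+ 2) LHN) (L1Z p LgN).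
have E1 : \int[P]_w (Fbar (y k w) - p / 2 * (sqn (gradF (y k w)) +
    sqn (mean (H k ^~ w)) - L ^+ 2 * disagreement k w)) =
    f k - p / 2 * (a k + b k - L ^+ 2 * v k).
  rewrite (exB Lf (L1Z (p / 2) Labv)) [X in _ - X](exZ _ Labv).
  by rewrite [X in _ * X](exB Lab LV) (exD La Lb) [X in _ * (_ - X)](exZ _ Lv).
have E2 : \int[P]_w (L / 2 * p ^+ 2 * (sqn (mean (H k ^~ w)) +
    sqn (mean (N k ^~ w)))) = L / 2 * p ^+ 2 * (b k + \int[P]_w sqn (mean (N k ^~ w))).
  by rewrite (exZ _ (L1D Lb Ln)) [X in _ * X](exD Lb Ln).
have E3 : \int[P]_w (L * p ^+ 2 * dot (mean (H k ^~ w)) (mean (N k ^~ w)) -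
       p * dot (gradF (y k w)) (mean (N k ^~ w))) = 0.
  exact: ex_comb_eq0.
have := ex_le (L1_Fbar k.+1) (L1D (L1D L1' L2') L3') (descent k).
rewrite (exD (L1D L1' L2') L3') [X in X + _](exD L1' L2') E1 E2 E3 addr0 => h.
have pp : 0 <= L / 2 * p ^+ 2.
  by apply: mulr_ge0; [apply: divr_ge0 => //; exact: ltW|exact: sqr_ge0].
exact: (replace_noise_bound h (ler_wpM2l pp (mean_N_variance k))).
Qed.

Let v_split k : v k <=
  7 / 2 * (\int[P]_w msq (dev N k ^~ w)) + 7 / 5 * (\int[P]_w msq (dev H k ^~ w)).
Proof.
have LN := L1_msq_dev k L2v_N; have LH := L1_msq_dev k L2v_H.
rewrite -(exZ _ LN) -(exZ _ LH) -(exD (L1Z _ LN) (L1Z _ LH)).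
apply: ex_le => [||w]; [exact: L1_disagreement|by apply: L1D; exact: L1Z|].
(* The larger factor goes to the noise, because the drift part feeds back into [v]. *)
have c0 : (0 : R) < 5 / 2 by rewrite divr_gt0.
have := msqD_young (dev N k ^~ w) (dev H k ^~ w) c0.
have -> : 1 + 5 / 2 = 7 / 2 :> R by field.
have -> : 1 + (5 / 2)^-1 = 7 / 5 :> R by field.
by under eq_fun do rewrite -x_sub_y.
Qed.

Let sum_drift K : \sum_(k < K) \int[P]_w msq (dev H k ^~ w) <=
  gamma ^+ 2 * (tau%:R / alpha) ^+ 2 * (5 / 4 * (K%:R * kappa ^+ 2) +
    5 * L ^+ 2 * (\sum_(k < K) v k) + alpha ^+ 2 * \sum_(k < K) b k).
Proof.
have LH k := L1_msq_dev k L2v_H.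
have Lt k : L1 P (fun w => 5 / 4 * kappa ^+ 2 + 5 * L ^+ 2 * disagreement k w +
     alpha ^+ 2 * sqn (mean (H k ^~ w))).
  apply: L1D; last by apply: L1Z; exact: L2v_sqn.
  by apply: L1D; [exact: L1_cst|exact: L1Z].
have Et k : \int[P]_w (5 / 4 * kappa ^+ 2 + 5 * L ^+ 2 * disagreement k w +
     alpha ^+ 2 * sqn (mean (H k ^~ w))) =
     5 / 4 * kappa ^+ 2 + 5 * L ^+ 2 * v k + alpha ^+ 2 * b k.
  have LV := L1Z (5 * L ^+ 2) (L1_disagreement k).
  have LB : L1 P (fun w => sqn (mean (H k ^~ w))) by exact: L2v_sqn.
  rewrite (exD (L1D (L1_cst P _) LV) (L1Z _ LB)) (exD (L1_cst P _) LV).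
  by rewrite ex_cst (exZ _ (L1_disagreement k)) (exZ _ LB).
rewrite -(ex_sum (index_enum _) (fun k : 'I_K => LH k)).
have Ls := L1_sum (index_enum _) (fun k : 'I_K => Lt k).
apply: le_trans (ex_le (L1_sum _ (fun k : 'I_K => LH k)) (L1Z _ Ls) (drift_gain K)) _.
rewrite (exZ _ Ls) (ex_sum _ (fun k : 'I_K => Lt k)).
under eq_bigr do rewrite Et.
rewrite !big_split /= sumr_const card_ord -!mulr_sumr.
by rewrite -[(5 / 4 * kappa ^+ 2) *+ K]mulr_natl [K%:R * _]mulrCA.
Qed.

Lemma overlap_local_sgd_bound K : 0 < K%:R :> R ->
  gamma = L^-1 * Num.sqrt (m%:R / K%:R) ->
  60 * m%:R * tau%:R ^+ 2 / alpha ^+ 2 <= K%:R ->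
  K%:R^-1 * (\sum_(k < K) \int[P]_w sqn (gradF (y k w))) <=
    4 * L * (Fbar x0 - finf) / ((1 - alpha) * Num.sqrt (m%:R * K%:R))
    + 2 * (1 - alpha) * sigma ^+ 2 / Num.sqrt (m%:R * K%:R)
    + 2 * m%:R * sigma ^+ 2 / K%:R * (2 / ((2 - alpha) * alpha) * tau%:R - 1)
    + 2 * m%:R * tau%:R ^+ 2 * kappa ^+ 2 / (alpha ^+ 2 * K%:R).
Proof.
move=> K0 gammaE hK.
have f0 : f 0%N = Fbar x0.
  rewrite /f -[RHS](ex_cst P); apply: eq_Rintegral => w _.
  by rewrite /y olsgd_y0.
apply: (@rate_from_budget R m%:R K%:R tau%:R alpha gamma L (sigma ^+ 2)
  (kappa ^+ 2) (Fbar x0) finf (\sum_(k < K) \int[P]_w sqn (gradF (y k w)))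
  (\sum_(k < K) b k) (\sum_(k < K) v k)
  (\sum_(k < K) \int[P]_w msq (dev N k ^~ w))
  (\sum_(k < K) \int[P]_w msq (dev H k ^~ w))).
- by rewrite ltr0n.
- exact: K0.
- by rewrite ler1n.
- exact: alpha01.
- exact: L_gt0.
- exact: sqr_ge0.
- exact: sqr_ge0.
- by apply: sumr_ge0 => k _; apply: Rintegral_ge0 => w _; exact: sqn_ge0.
- by apply: sumr_ge0 => k _; apply: Rintegral_ge0 => w _; exact: msq_ge0.
- exact: finf_le.
- exact: gammaE.
- exact: hK.
- have tele := sum_descent K descent_ex.
  have fK : finf <= f K.
    rewrite -(ex_cst P finf); apply: ex_le => //; exact: L1_cst.
  apply: le_trans tele _; rewrite f0 lerD2r lerD2l lerN2; exact: fK.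
- by rewrite !mulr_sumr -big_split; apply: ler_sum => k _; exact: v_split.
- apply: (@le_trans _ _ (\sum_(k < K)
    gamma ^+ 2 * sigma ^+ 2 * (tau%:R / ((2 - alpha) * alpha) - 1))).
    apply: ler_sum => k _; apply: le_trans (dev_N_variance k) _.
    apply: ler_wpM2l; first exact: mulr_ge0 (sqr_ge0 _) (sqr_ge0 _).
    (* In this form the residue, at most [tau - 1], combines with [- tau] to give the constant
       [- 1]. *)
    have -> : tau%:R * (1 - alpha) ^+ 2 / ((2 - alpha) * alpha) =
        tau%:R / ((2 - alpha) * alpha) - tau%:R.
      have [a0 a1] := andP alpha01; field; rewrite gt_eqF//= gt_eqF//.
      by rewrite subr_gt0 (lt_trans a1)// ltr1n.
    rewrite -addrA lerD2l lerNr opprD opprK lerBrDl natr1 ler_nat.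
    exact: ltn_pmod.
  by rewrite sumr_const card_ord [leRHS]mulr_natl.
- exact: sum_drift.
Qed.

End Convergence.

Theorem theorem1
  (R : realType) (d m : nat) (hm : (0 < m)%N)
  (* probability space carrying all the random mini-batches *)
  (dO : measure_display) (O : measurableType dO) (P : probability O R)
  (* mini-batch space and the distributions D_i *)
  (dX : measure_display) (Xi : measurableType dX) (D : 'I_m -> probability Xi R)
  (* local objectives F_i, stochastic gradients g_i *)
  (F : 'I_m -> 'rV[R]_d -> R) (g : 'I_m -> 'rV[R]_d -> Xi -> 'rV[R]_d)
  (L sigma kappa : R)
  (tau : nat) (alpha : R) (K : nat) (gamma : R) (x0 : 'rV[R]_d)
  (xi : nat -> 'I_m -> O -> Xi) :
  let Fbar := fun x => (m%:R)^-1 * \sum_(i < m) F i x in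
  (* F bounded below, F_inf = inf F *)
  has_lbound (range Fbar) ->
  let Finf := inf (range Fbar) in
  (* each F_i differentiable and L-smooth *)
  (forall i x, differentiable (F i) x) ->
  (forall i x y, enorm (grad (F i) x - grad (F i) y) <= L * enorm (x - y)) ->
  (* stochastic gradients: measurable, unbiased, bounded variance *)
  (forall i (j : 'I_d),
     measurable_fun setT (fun p : d.-tuple R * Xi => g i (vec_of_tuple p.1) p.2 0 j)) ->
  (forall i x (j : 'I_d),
     (D i).-integrable setT (fun s => (g i x s 0 j)%:E) /\
     (\int[D i]_s (g i x s 0 j)%:E = (grad (F i) x 0 j)%:E)%E) ->
  (forall i x,
     (\int[D i]_s (enorm (g i x s - grad (F i) x) ^+ 2)%:E <= (sigma ^+ 2)%:E)%E) ->
  (* bounded dissimilarity *)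
  (forall x, (m%:R)^-1 * \sum_(i < m) enorm (grad (F i) x - grad Fbar x) ^+ 2
               <= kappa ^+ 2) ->
  (* fresh mini-batches: xi k i ~ D_i, all mutually independent *)
  (forall k i, measurable_fun setT (xi k i)) ->
  (forall k i A, measurable A -> P (xi k i @^-1` A) = D i A) ->
  mutually_independent P (fun p : nat * 'I_m => xi p.1 p.2) ->
  (* parameters *)
  (0 < tau)%N -> 0 < alpha < 1 -> 0 < gamma ->
  gamma = L^-1 * Num.sqrt (m%:R / K%:R) ->
  K%:R >= 60 * m%:R * (tau%:R) ^+ 2 / alpha ^+ 2 ->
  let y := fun k w => olsgd_y g gamma alpha tau x0 (fun k' i => xi k' i w) k in
  ((((K%:R)^-1)%:E *
    (\sum_(k < K) 'E_P[fun w => (enorm (grad Fbar (y k w)) ^+ 2)%R]))%E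
  <= ((4 * L * (Fbar (y 0%N (point : O)) - Finf) / ((1 - alpha) * Num.sqrt (m%:R * K%:R))
      + 2 * (1 - alpha) * sigma ^+ 2 / Num.sqrt (m%:R * K%:R)
      + 2 * m%:R * sigma ^+ 2 / K%:R * (2 / ((2 - alpha) * alpha) * tau%:R - 1)
      + 2 * m%:R * tau%:R ^+ 2 * kappa ^+ 2 / (alpha ^+ 2 * K%:R))%R%:E))%E.
Proof.
move=> Fbar hlb Finf dF lipF mg unb var dis mxi law indep tau0 a01 g0 gE hK; cbv zeta.
(* The inverse of 0 is 0, so [K = 0] would force [gamma = 0]; the sign of [gamma] likewise yields
   [0 < L]. *)
have K0 : (0 < K)%N.
  rewrite lt0n; apply/eqP => K0; move: g0.
  by rewrite gE K0 invr0 mulr0 sqrtr0 mulr0 ltxx.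
have L0 : 0 < L.
  move: g0; rewrite gE; case: (ltP 0 L) => // L0.
  by rewrite ltNge mulr_le0_ge0 ?invr_le0 ?sqrtr_ge0.
have gradE v : grad Fbar v = mean (fun i => grad (F i) v) by exact: grad_mean.
have smooth i u v : sqn (grad (F i) u - grad (F i) v) <= L ^+ 2 * sqn (u - v).
  rewrite -!enorm_sqr -exprMn ler_pXn2r ?nnegrE ?sqrtr_ge0//.
  by rewrite mulr_ge0 ?sqrtr_ge0// ltW.
have dissim v :
    msq (fun i => grad (F i) v - mean (fun i => grad (F i) v)) <= kappa ^+ 2.
  apply: le_trans (dis v); rewrite /msq ler_wpM2l ?invr_ge0//.
  by apply: ler_sum => i _; rewrite enorm_sqr gradE.
have finf v : Finf <= Fbar v by apply: ge_inf => //; exists v.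
have K0' : 0 < K%:R :> R by rewrite ltr0n.
have bound := overlap_local_sgd_bound x0 hm L0 tau0 a01 g0 dF smooth mg unb var
  dissim mxi law indep finf K0' gE hK.
have EE k : ('E_P[fun w => (enorm (grad Fbar
    (olsgd_y g gamma alpha tau x0 (fun k' i => xi k' i w) k)) ^+ 2)%R])%E =
    (\int[P]_w sqn (mean (fun i => grad (F i)
      (olsgd_y g gamma alpha tau x0 (fun k' i => xi k' i w) k))))%:E.
  have int := L1_sqn_gradient tau alpha gamma x0 L0 smooth mg var mxi law indep k.
  rewrite unlock /Rintegral fineK; last exact: (integrable_fin_num measurableT int).
  by apply: eq_integral => w _; rewrite enorm_sqr gradE.
under eq_bigr do rewrite EE.
(* The initial iterate is [x0] for every outcome, so evaluating it at [point] is harmless. *)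
rewrite olsgd_y0// sumEFin -EFinM lee_fin; exact: bound.
Qed.
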